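(* Let $K$ be a compact subset of the unit disc $\mathbb{D}=\{z\in\mathbb{C}:|z|<1\}$. Then there exist a constant $C$ and a number $\varepsilon_0>0$, depending on $K$, such that for every $0<\varepsilon<\varepsilon_0$ and every domain $W\subset\mathbb{C}$ with $K\subseteq W$ and $H(\partial\mathbb{D},\partial W)\le\varepsilon$, one has $$|\rho_{\mathbb{D}}(z)-\rho_W(z)|\le C\varepsilon\qquad\text{for all } z\in K.$$
   Context: All distances are Euclidean. For sets $A,B\subset\mathbb{C}$, the Hausdorff distance is $H(A,B)=\inf\{r>0: A\subseteq N_r(B)\text{ and }B\subseteq N_r(A)\}$, where $N_r(A)$ is the set of points whose distance from $A$ is less than $r$. For a hyperbolic domain $A$ (one whose boundary in the Riemann sphere has at least 3 points) and $z\in A$, $\rho_A(z)$ denotes the hyperbolic density normalized to have curvature $-4$, i.e. $\rho_A(z)=1/|\pi'(0)|$, where $\pi$ is a holomorphic covering map from $\mathbb{D}$ onto $A$ with $\pi(0)=z$. *)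

(* Defs.v *)
From HB Require Import structures.
From mathcomp Require Import all_boot all_order all_algebra.
From mathcomp Require Import complex.
From mathcomp Require Import all_classical all_reals all_analysis.
Import Order.TTheory GRing.Theory Num.Theory.
Import numFieldNormedType.Exports.
Set Implicit Arguments.
Unset Strict Implicit.
Unset Printing Implicit Defensive.

Local Open Scope classical_set_scope.
Local Open Scope ring_scope.
Local Open Scope complex_scope.

(* MathComp-Analysis gives every abstract numFieldType K the topology and norm
   of K^o, but canonical inference does not find them on the concrete type
   R[i]; we copy them, so that R[i] carries the Euclidean topology and
   [derivable] and [derive1] on R[i] are complex differentiation. *)
HB.instance Definition _ (R : realType) := GRing.ComAlgebra.copy R[i] R[i]^o.
HB.instance Definition _ (R : realType) := Vector.copy R[i] R[i]^o.
HB.instance Definition _ (R : realType) := NormedModule.copy R[i] R[i]^o.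

Section covering.
Context {X Y : topologicalType}.

Definition homeo_on (p : X -> Y) (V : set X) (U : set Y) :=
  [/\ set_bij V U p, {within V, continuous p} &
    exists2 s : Y -> X, {within U, continuous s} &
      forall x, V x -> s (p x) = x].

Definition evenly_covered (E : set X) (p : X -> Y) (U : set Y) :=
  exists S : set (set X),
    [/\ E `&` p @^-1` U = \bigcup_(V in S) V,
        trivIset S id &
        forall V, S V -> open V /\ homeo_on p V U].

(* Only meant for open E and A: sheets and evenly covered neighbourhoods are
   required to be open in the ambient spaces. The values of p outside E are
   irrelevant. *)
Definition covering_map (E : set X) (A : set Y) (p : X -> Y) :=
  [/\ {within E, continuous p}, p @` E = A &
      forall y, A y ->
        exists U, [/\ open U, U y, U `<=` A & evenly_covered E p U]].

End covering.

Section hyperbolic.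
Context {R : realType}.
Local Notation C := R[i].

Definition domain (W : set C) := [/\ open W, connected W & W !=set0].

Definition boundary (A : set C) : set C := closure A `\` interior A.

Definition unit_disc : set C := [set z | `|z| < 1].

(* The points at distance less than r from A (none when A is empty). *)
Definition neighborhood (r : R) (A : set C) : set C :=
  \bigcup_(a in A) ball a r%:C.

(* Valued in \bar R: the distance is +oo when no r is admissible. *)
Definition hausdorff_dist (A B : set C) : \bar R :=
  ereal_inf [set r%:E | r in
    [set r : R | [/\ 0 < r, A `<=` neighborhood r B &
                     B `<=` neighborhood r A]]].

Definition holomorphic_on (A : set C) (f : C -> C) :=
  forall z, A z -> derivable f z 1.

(* rho is the hyperbolic density (curvature -4) of A at z. The density is
   rendered as a relation, since it is defined through a choice of covering
   map. The condition that A be hyperbolic is implied: a plane domain covered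
   by the disc has at least 3 boundary points in the Riemann sphere. *)
Definition hyperbolic_density (A : set C) (z : C) (rho : R) :=
  exists p : C -> C,
    [/\ holomorphic_on unit_disc p, covering_map unit_disc A p, p 0 = z &
        rho = (Normc.normc (derive1 p 0))^-1].

End hyperbolic.

(* Main.v *)
Require Import Defs.
From mathcomp Require Import all_boot all_order all_algebra.
From mathcomp Require Import complex ring lra.
From mathcomp Require Import all_classical all_reals all_analysis.
Import Order.TTheory GRing.Theory Num.Theory.
Import numFieldNormedType.Exports.
Set Implicit Arguments.
Unset Strict Implicit.
Unset Printing Implicit Defensive.
Local Open Scope classical_set_scope.
Local Open Scope ring_scope.
Local Open Scope complex_scope.

(* Let rho_r(z) = r / (r^2 - |z|^2) be the density of the disc |z| < r, and put
   e = 2 eps. Both the unit disc and W contain the disc |z| <= 1 - e; lifting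
   this disc through the covering map and applying Schwarz-Pick to the lift
   bounds both densities above by rho_(1-e). Conversely every point of the unit
   circle lies within 7 e of two omitted points which are at least e apart. An
   explicit metric of curvature at most -4 on the plane minus two points then
   shows that the density is at least 1 / (6000 e) on the unit circle, hence at
   least rho_R there for R = 1 + 6000 e, and Ahlfors' maximum principle argument
   extends this comparison to the whole unit disc. Finally
   rho_(1-e) - rho_R = O(e) on K.

   Holomorphy only means differentiability at each point. Goursat's lemma on
   rectangles, in logarithmic coordinates, gives the mean value property and the
   maximum modulus principle; bounding divided differences with the latter gives
   removable singularities and the smoothness of derivatives. Ahlfors' argument
   needs only second-order expansions at a maximum. *)

(** * Complex differentiation *)


(** A small Hausdorff distance between the boundaries does not keep W inside a slightly larger disc:
    W may be the plane without finitely many points close to the unit circle. So monotonicity of the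
    density yields only the upper bound. All that W is sure to miss is a net along the circle, of
    mesh comparable to e; this is why the lower bound starts from a metric of the plane minus two
    points, scaled by e. On the circle that metric has density of order 1 / e, which is also the
    order of the density of a disc of radius 1 + O(e). This match makes the final error linear in
    eps.

    A density is accessible only through some covering map of the unit disc. Hence each bound
    compares such a map, or a lift through it, with an explicit metric. *)

Section ComplexBasics.
Context {R : realType}.
Local Notation C := R[i].
Local Notation N := (@Normc.normc R).
Local Notation re := (@complex.Re R).
Local Notation im := (@complex.Im R).
Implicit Types (x y z w l k : C) (f g : C -> C) (e d r : R).

Lemma normCE z : `|z| = (N z)%:C.
Proof. by []. Qed.

Lemma N_ge0 z : 0 <= N z.
Proof. by case: z => a b; exact: sqrtr_ge0. Qed.

Lemma N_distC z w : N (z - w) = N (w - z).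
Proof. by rewrite -normcN opprB. Qed.

Lemma N_eq0 z : (N z == 0) = (z == 0).
Proof. by apply/eqP/eqP => [/Normc.eq0_normc//|->]; rewrite Normc.normc0. Qed.

Lemma N_gt0 z : (0 < N z) = (z != 0).
Proof. by rewrite lt_neqAle N_ge0 andbT eq_sym N_eq0. Qed.

Lemma N_real (a : R) : N a%:C = `|a|.
Proof. by rewrite /Normc.normc /= expr0n addr0 sqrtr_sqr. Qed.

Lemma N_sqr z : N z ^+ 2 = re z ^+ 2 + im z ^+ 2.
Proof. by case: z => a b /=; rewrite sqr_sqrtr // addr_ge0 ?sqr_ge0. Qed.

Lemma re_le_N z : `|re z| <= N z.
Proof.
rewrite -(ler_pXn2r (n:=2)) ?nnegrE ?N_ge0 ?normr_ge0//.
by rewrite real_normK ?num_real// N_sqr lerDl sqr_ge0.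
Qed.

Lemma im_le_N z : `|im z| <= N z.
Proof.
rewrite -(ler_pXn2r (n:=2)) ?nnegrE ?N_ge0 ?normr_ge0//.
by rewrite real_normK ?num_real// N_sqr lerDr sqr_ge0.
Qed.

Lemma N_le_ReIm z : N z <= `|re z| + `|im z|.
Proof.
rewrite -(ler_pXn2r (n:=2)) ?nnegrE ?N_ge0 ?addr_ge0 ?normr_ge0//.
rewrite N_sqr sqrrD !real_normK ?num_real//.
have := mulr_ge0 (normr_ge0 (re z)) (normr_ge0 (im z)); nra.
Qed.

Lemma N_exp z n : N (z ^+ n) = N z ^+ n.
Proof.
by elim: n => [|n IH]; rewrite ?expr0 ?Normc.normc1// !exprS Normc.normcM IH.
Qed.

Lemma N_sub_le z w : N z - N w <= N (z - w).
Proof. by rewrite lerBlDr -{1}(subrK w z) le_normcD. Qed.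

Lemma N_dist_le z w : `|N z - N w| <= N (z - w).
Proof. by rewrite ler_norml N_sub_le andbT lerNl opprB N_distC N_sub_le. Qed.

Lemma N_tri x y z : N (x - z) <= N (x - y) + N (y - z).
Proof. by rewrite -[x - z](subrKA y) le_normcD. Qed.

Lemma reD z w : re (z + w) = re z + re w. Proof. by case: z w => [? ?] []. Qed.
Lemma imD z w : im (z + w) = im z + im w. Proof. by case: z w => [? ?] []. Qed.
Lemma reB z w : re (z - w) = re z - re w. Proof. by case: z w => [? ?] []. Qed.
Lemma imB z w : im (z - w) = im z - im w. Proof. by case: z w => [? ?] []. Qed.
Lemma reM z w : re (z * w) = re z * re w - im z * im w.
Proof. by case: z w => [? ?] []. Qed.
Lemma imM z w : im (z * w) = re z * im w + im z * re w.
Proof. by case: z w => [? ?] []. Qed.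

Lemma ballCP z (r : R) w : ball z r%:C w <-> N (w - z) < r.
Proof. by rewrite -ball_normE /ball_ /= normCE ltcR N_distC. Qed.

Lemma nbhsCP z (P : set C) :
  nbhs z P <-> exists2 d, 0 < d & forall w, N (w - z) < d -> P w.
Proof.
split.
- move/nbhs_ballP => [e /= e0 eP].
  have [E0 eE]: 0 < re e /\ e = (re e)%:C.
    by move: e0; rewrite ltcE; case: (e) => a b /= /andP[/eqP-> ?].
  exists (re e) => // w wd; apply: eP; rewrite eE; exact/ballCP.
- move=> [d d0 dP]; apply/nbhs_ballP; exists d%:C; first by rewrite /= ltcR.
  by move=> w /ballCP; exact: dP.
Qed.

(* Inductive wrappers, so that unification never unfolds the filters on R[i]. *)
Variant ctends f z l : Prop := CTends of f @ z --> l.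
Variant rtends (u : C -> R) z (l : R) : Prop := RTends of u @ z --> l.

Lemma ctendsP f z l : ctends f z l <->
  forall e, 0 < e -> exists2 d, 0 < d & forall w, N (w - z) < d -> N (f w - l) < e.
Proof.
split=> [[fl] e e0|H].
  have /fl : nbhs l [set y | N (y - l) < e] by apply/nbhsCP; exists e.
  by move/nbhsCP.
constructor=> A /nbhsCP[e e0 eA].
have [d d0 dP] := H e e0.
by apply/nbhsCP; exists d => // w /dP /eA.
Qed.

Lemma rtendsP (u : C -> R) z (l : R) : rtends u z l <->
  forall e, 0 < e -> exists2 d, 0 < d & forall w, N (w - z) < d -> `|u w - l| < e.
Proof.
split=> [[fl] e e0|H].
  have /fl : nbhs l [set y | `|y - l| < e].
    by apply/nbhs_ballP; exists e => //= y; rewrite /ball /= distrC.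
  by move/nbhsCP.
constructor=> A /nbhs_ballP[e e0 eA].
have [d d0 dP] := H e e0.
apply/nbhsCP; exists d => // w /dP h; apply: eA.
by rewrite /ball /= distrC.
Qed.

Lemma rtends_normc z : rtends N z (N z).
Proof.
apply/rtendsP => e e0; exists e => // w.
by apply: le_lt_trans; exact: N_dist_le.
Qed.

Lemma ctends_cst (c : C) z : ctends (fun _ : C => c) z c.
Proof. by constructor; exact: (@cst_continuous C C c z). Qed.

Lemma ctends_id z : ctends (fun w : C => w) z z.
Proof. by apply/ctendsP => e e0; exists e. Qed.

Lemma ctendsD f g z l k : ctends f z l -> ctends g z k -> ctends (fun w => f w + g w) z (l + k).
Proof. by move=> [fl] [gk]; constructor; exact: (@cvgD _ _ _ (nbhs z) _ f g l k fl gk). Qed.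

Lemma ctendsM f g z l k : ctends f z l -> ctends g z k -> ctends (fun w => f w * g w) z (l * k).
Proof. by move=> [fl] [gk]; constructor; exact: (@cvgM _ _ (nbhs z) _ f g l k fl gk). Qed.

Lemma ctendsN f z l : ctends f z l -> ctends (fun w => - f w) z (- l).
Proof. by move=> [fl]; constructor; exact: (@cvgN _ _ _ (nbhs z) _ f l fl). Qed.

Lemma ctendsB f g z l k : ctends f z l -> ctends g z k -> ctends (fun w => f w - g w) z (l - k).
Proof. by move=> [fl] [gk]; constructor; exact: (@cvgB _ _ _ (nbhs z) _ f g l k fl gk). Qed.

Lemma ctendsV f z l : l != 0 -> ctends f z l -> ctends (fun w => (f w)^-1) z (l^-1).
Proof. by move=> l0 [fl]; constructor; exact: (@cvgV _ _ (nbhs z) _ f l l0 fl). Qed.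

Lemma ctends_comp f g z k l :
  ctends f z k -> ctends g k l -> ctends (fun w => g (f w)) z l.
Proof. by move=> [fk] [gl]; constructor; apply: cvg_comp fk gl. Qed.

Lemma ctends_rcomp f (u : C -> R) z k (l : R) :
  ctends f z k -> rtends u k l -> rtends (fun w => u (f w)) z l.
Proof. by move=> [fk] [gl]; constructor; apply: cvg_comp fk gl. Qed.

Lemma rtends_N f z l : ctends f z l -> rtends (fun w => N (f w)) z (N l).
Proof. by move=> fl; exact: (ctends_rcomp fl (@rtends_normc l)). Qed.

Lemma ctends_unique f z l : ctends f z l -> f z = l.
Proof.
move=> /ctendsP fl; apply/eqP; rewrite -subr_eq0 -N_eq0 eq_le N_ge0 andbT.
apply/ler_addgt0Pr => e /fl[d d0 H]; rewrite add0r.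
by apply/ltW/H; rewrite subrr Normc.normc0.
Qed.

Lemma ctends_near f g z l :
  (exists2 d, 0 < d & forall w, N (w - z) < d -> f w = g w) ->
  ctends f z l -> ctends g z l.
Proof.
move=> [d d0 fg] /ctendsP fl; apply/ctendsP => e /fl[d' d'0 H].
exists (Num.min d d') => [|w]; first by rewrite lt_min d0.
by rewrite lt_min => /andP[wd wd']; rewrite -fg// H.
Qed.

(** Caratheodory's form of differentiability, with a slope Q continuous at z. The product and chain
    rules become algebra with slopes, and slopes are later studied as functions in their own
    right. *)
Definition cder f z l := exists Q : C -> C,
  [/\ forall w, f w - f z = Q w * (w - z), Q z = l & ctends Q z l].

Lemma cderP f z l : cder f z l <-> forall e, 0 < e ->
  exists2 d, 0 < d & forall w, N (w - z) < d ->
    N (f w - f z - l * (w - z)) <= e * N (w - z).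
Proof.
split.
  move=> [Q [fQ _ /ctendsP Ql]] e e0.
  have [d d0 H] := Ql e e0; exists d => // w wd.
  by rewrite fQ -mulrBl Normc.normcM ler_wpM2r ?N_ge0// ltW// H.
move=> H; exists (fun w => if w == z then l else (f w - f z) / (w - z)); split.
- move=> w; case: eqVneq => [->|wz]; first by rewrite !subrr mulr0.
  by rewrite divfK // subr_eq0.
- by rewrite eqxx.
- apply/ctendsP => e e0; have e20 : 0 < e / 2 by rewrite divr_gt0.
  have [d d0 {}H] := H _ e20; exists d => // w wd.
  case: eqVneq => [_|wz]; first by rewrite subrr Normc.normc0.
  have wz0 : w - z != 0 by rewrite subr_eq0.
  rewrite -[l](mulfK wz0) -mulrBl Normc.normcM Normc.normcV //.
  rewrite ltr_pdivrMr ?N_gt0//.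
  by apply: le_lt_trans (H _ wd) _; rewrite ltr_pM2r ?N_gt0//; lra.
Qed.

Lemma cder_unique f z l l' : cder f z l -> cder f z l' -> l = l'.
Proof.
move=> /cderP H /cderP H'; apply/eqP; rewrite -subr_eq0 -N_eq0 eq_le N_ge0 andbT.
apply/ler_addgt0Pr => e e0; rewrite add0r.
have e20 : 0 < e / 2 by rewrite divr_gt0.
have [d d0 {}H] := H _ e20; have [d' d'0 {}H'] := H' _ e20.
pose h := Num.min d d' / 2.
have m0 : 0 < Num.min d d' by rewrite lt_min d0.
have h0 : 0 < h by rewrite divr_gt0.
have hm : h < Num.min d d' by rewrite /h; lra.
move: hm; rewrite lt_min => /andP[hd hd'].
have Nh : N (z + h%:C - z) = h by rewrite addrC addKr N_real gtr0_norm.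
have := H (z + h%:C); have := H' (z + h%:C); rewrite Nh => /(_ hd') A /(_ hd) B.
have zh : z + h%:C - z = h%:C by rewrite addrC addKr.
rewrite !zh in A, B.
set u := f (z + h%:C) - f z in A B.
have : N ((l - l') * h%:C) <= e * h.
  have -> : (l - l') * h%:C = (u - l' * h%:C) - (u - l * h%:C) by ring.
  by apply: le_trans (le_normcD _ _) _; rewrite normcN; lra.
by rewrite Normc.normcM N_real gtr0_norm// ler_pM2r.
Qed.

Lemma cder_cont f z l : cder f z l -> ctends f z (f z).
Proof.
move=> [Q [fQ _ Ql]].
have H : ctends (fun w => f z + Q w * (w - z)) z (f z + l * (z - z)).
  apply: ctendsD; first exact: ctends_cst.
  exact: (ctendsM Ql (ctendsB (ctends_id z) (ctends_cst z z))).
have E : (fun w => f z + Q w * (w - z)) = f by apply/funext => w; rewrite -fQ subrKC.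
by move: H; rewrite E subrr mulr0 addr0.
Qed.

Lemma cder_near f g z l :
  (exists2 d, 0 < d & forall w, N (w - z) < d -> f w = g w) ->
  cder f z l -> cder g z l.
Proof.
move=> [d d0 fg] /cderP H; apply/cderP => e /H[d' d'0 {}H].
exists (Num.min d d') => [|w]; first by rewrite lt_min d0.
rewrite lt_min => /andP[wd wd']; rewrite -!fg ?H//.
by rewrite subrr Normc.normc0.
Qed.

Lemma cder_cst (c : C) z : cder (fun=> c) z 0.
Proof.
by exists (fun=> 0); split => // [w|]; [rewrite subrr mul0r|exact: ctends_cst].
Qed.

Lemma cder_id z : cder id z 1.
Proof. by exists (fun=> 1); split => // [w|]; [rewrite mul1r|exact: ctends_cst]. Qed.

Lemma cderD f g z l k : cder f z l -> cder g z k -> cder (fun w => f w + g w) z (l + k).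
Proof.
move=> [P [fP Pz Pl]] [Q [gQ Qz Ql]]; exists (fun w => P w + Q w); split.
- by move=> w; rewrite mulrDl -fP -gQ; ring.
- by rewrite Pz Qz.
- exact: (ctendsD Pl Ql).
Qed.

Lemma cderM f g z l k : cder f z l -> cder g z k ->
  cder (fun w => f w * g w) z (l * g z + f z * k).
Proof.
move=> fl gk; have gc := cder_cont gk.
move: fl gk => [P [fP Pz Pl]] [Q [gQ Qz Ql]].
exists (fun w => P w * g w + f z * Q w); split.
- by move=> w; rewrite mulrDl -mulrA (mulrC (g w)) mulrA -fP -mulrA -gQ; ring.
- by rewrite Pz Qz.
- exact: (ctendsD (ctendsM Pl gc) (ctendsM (ctends_cst (f z) z) Ql)).
Qed.

Lemma cderZ f z l (c : C) : cder f z l -> cder (fun w => c * f w) z (c * l).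
Proof.
move=> fl; have := cderM (cder_cst c z) fl; by rewrite mul0r add0r.
Qed.

Lemma cderB f g z l k : cder f z l -> cder g z k -> cder (fun w => f w - g w) z (l - k).
Proof.
move=> fl gk; rewrite -mulN1r; have := cderD fl (cderZ (-1) gk).
by under eq_fun do rewrite mulN1r.
Qed.

Lemma cder_comp f g z l k : cder f z l -> cder g (f z) k -> cder (fun w => g (f w)) z (k * l).
Proof.
move=> fl; have fc := cder_cont fl.
move: fl => [P [fP Pz Pl]] [Q [gQ Qz Ql]]; exists (fun w => Q (f w) * P w); split.
- by move=> w; rewrite gQ fP mulrA.
- by rewrite Pz Qz.
- exact: (ctendsM (ctends_comp fc Ql) Pl).
Qed.

Lemma cderV f z l : f z != 0 -> cder f z l -> cder (fun w => (f w)^-1) z (- l / f z ^+ 2).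
Proof.
move=> fz0 fl; have fc := cder_cont fl.
have fi : ctends (fun w => (f w)^-1) z ((f z)^-1) := ctendsV fz0 fc.
have [d d0 fd] : exists2 d, 0 < d & forall w, N (w - z) < d -> f w != 0.
  have /ctendsP/(_ (N (f z))) := fc; rewrite N_gt0 => /(_ fz0)[d d0 H].
  exists d => // w /H; apply: contraTneq => ->.
  by rewrite add0r normcN ltxx.
move: fl => [P [fP Pz Pl]].
(* The factorisation is required at every w, so zeros of f get the plain difference quotient; none
   of them is near z. *)
exists (fun w => if f w == 0 then ((f w)^-1 - (f z)^-1) / (w - z) else - P w * (f w)^-1 / f z); split.
- move=> w; case: eqVneq => [fw0|fw0].
    rewrite divfK// subr_eq0; apply: contraNneq fz0 => <-; exact/eqP.
  have e : P w * (w - z) = f w - f z by rewrite fP.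
  transitivity (- (P w * (w - z)) / (f w * f z)); last by rewrite invfM; ring.
  by rewrite e; field; rewrite fz0 fw0.
- by rewrite (negPf fz0) Pz expr2 invfM; ring.
- apply: (@ctends_near (fun w => - P w * (f w)^-1 / f z)).
    by exists d => // w /fd /negPf ->.
  have -> : - l / f z ^+ 2 = - l * (f z)^-1 / f z by rewrite expr2 invfM; ring.
  exact: (ctendsM (ctendsM (ctendsN Pl) fi) (ctends_cst _ z)).
Qed.

Lemma cder_derivable f z : derivable f z 1 -> cder f z (derive1 f z).
Proof.
move=> fz; have : (fun h => h^-1 *: (f (h + z) - f z)) @ 0^' --> derive1 f z.
  rewrite derive1E; move: fz; rewrite /derivable /derive.
  have -> : (fun h : C => h^-1 *: ((f \o shift z) (h *: 1) - f z)) =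
            (fun h => h^-1 *: (f (h + z) - f z)).
    by apply/funext => h; rewrite /= /shift /GRing.scale /= mulr1.
  by [].
move=> H; apply/cderP => e e0.
have /H : nbhs (derive1 f z) [set y | N (y - derive1 f z) < e].
  by apply/nbhsCP; exists e.
rewrite /= /nbhs /= => /nbhsCP[d d0 {}H]; exists d => // w wd.
have [->|wz] := eqVneq w z; first by rewrite !subrr mulr0 subrr Normc.normc0 mulr0.
have wz0 : w - z != 0 by rewrite subr_eq0.
have := H (w - z); rewrite subr0 => /(_ wd) /(_ wz0) /=.
rewrite subrK /GRing.scale /= => /ltW h.
have -> : f w - f z - f^`()%classic z * (w - z) =
  ((w - z)^-1 * (f w - f z) - f^`()%classic z) * (w - z).
  by rewrite mulrBl mulrAC mulVf// mul1r.
by rewrite Normc.normcM ler_wpM2r ?N_ge0.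
Qed.

End ComplexBasics.

(** * Goursat's lemma for closed 1-forms *)


Section Goursat.
Context {R : realType}.
Implicit Types (f F : R -> R) (a b x y s t e d : R).

Lemma is_derive_cont F f s t : (forall x, s <= x <= t -> is_derive x 1 F (f x)) ->
  {within `[s, t], continuous F}.
Proof.
move=> H; apply: derivable_within_continuous => x; rewrite in_itv /= => /H[].
by [].
Qed.

Lemma antiderivative f a b : a < b -> (forall x, continuous_at x f) ->
  exists F, forall x, a < x -> x < b -> is_derive x 1 F (f x).
Proof.
move=> ab cf.
have intf : (@lebesgue_measure R).-integrable `[a, b] (EFin \o f).
  apply: continuous_compact_integrable; first exact: segment_compact.
  by apply: continuous_subspaceT => x; exact: cf.
exists (fun x => \int[@lebesgue_measure R]_(t in [set` `[a, x]]) f t)%R => x ax xb.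
have [d1 d2] := continuous_FTC1_closed xb intf ax (cf x).
by split; [exact: d1|rewrite -derive1E; exact: d2].
Qed.

(** The mean value theorem, applied to F minus the quadratic primitive of the affine approximation,
    stands in for an estimate of integrals. *)
Lemma quad_increment F f (c k o E s t : R) : s <= t ->
  (forall x, s <= x <= t -> is_derive x 1 F (f x)) ->
  (forall x, s <= x <= t -> `|f x - (c + k * (x - o))| <= E) ->
  `|F t - F s - (c * (t - s) + k * ((t - o) ^+ 2 - (s - o) ^+ 2) / 2)| <= E * (t - s).
Proof.
move=> st dF fE.
pose G x := F x - (c * x + k / 2 * (x - o) ^+ 2).
have dG x : s <= x <= t -> is_derive x 1 G (f x - (c + k * (x - o))).
  move=> /dF H; rewrite /G; apply: is_derive_eq.
  by rewrite /GRing.scale /=; field.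
have cG := is_derive_cont dG.
have [y yst] : exists2 y, y \in `[s, t] & G t - G s = (f y - (c + k * (y - o))) * (t - s).
  apply: MVT_segment st _ cG => x; rewrite in_itv /= => /andP[/ltW sx /ltW xt].
  by apply: dG; rewrite sx xt.
move: yst; rewrite in_itv /= => yst GE.
have -> : F t - F s - (c * (t - s) + k * ((t - o) ^+ 2 - (s - o) ^+ 2) / 2) = G t - G s.
  by rewrite /G; field.
by rewrite GE normrM (ger0_norm (x := t - s)) ?subr_ge0// ler_wpM2r ?subr_ge0// fE.
Qed.

Variables (u v A B : R -> R -> R) (X Y w h : R).
Hypotheses (w0 : 0 <= w) (h0 : 0 <= h).
Let inX x := X <= x <= X + w.
Let inY y := Y <= y <= Y + h.
Hypothesis dA : forall x y, inX x -> inY y -> is_derive x 1 (fun t => A t y) (v x y).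
Hypothesis dB : forall x y, inX x -> inY y -> is_derive y 1 (fun t => B x t) (u x y).

(* The condition p = u_x = v_y says that the form v dx + u dy is closed. *)
Hypothesis diff_uv : forall a b, inX a -> inY b -> exists p q q', forall e, 0 < e ->
  exists2 d, 0 < d & forall x y, inX x -> inY y -> `|x - a| < d -> `|y - b| < d ->
    `|u x y - u a b - (p * (x - a) + q * (y - b))| <= e * (`|x - a| + `|y - b|) /\
    `|v x y - v a b - (q' * (x - a) + p * (y - b))| <= e * (`|x - a| + `|y - b|).

(** Circulation of [v dx + u dy] around the rectangle with lower left corner (x, y) and sides s and
    t. Each side is an increment of a partial primitive, so subdivision is pure cancellation. *)
Let I x y s t := (A (x + s) y - A x y) - (A (x + s) (y + t) - A x (y + t))
  + (B (x + s) (y + t) - B (x + s) y) - (B x (y + t) - B x y).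

(** The affine parts of u and v have zero circulation, thanks to the common coefficient p. Each side
    leaves an error of at most e / 2 * (s + t) times its length. *)
Lemma goursat_local a b e : inX a -> inY b -> 0 < e -> exists2 d, 0 < d &
  forall x y s t, 0 <= s -> 0 <= t -> s < d -> t < d -> x <= a <= x + s -> y <= b <= y + t ->
    inX x -> inY y -> inX (x + s) -> inY (y + t) ->
  `|I x y s t| <= e * (s + t) ^+ 2.
Proof.
move=> Xa Yb e0; have [p [q [q' H]]] := diff_uv Xa Yb.
have e20 : 0 < e / 2 by rewrite divr_gt0.
have [d d0 {}H] := H _ e20; exists d => // x y s t s0 t0 sd td.
move=> /andP[xa ax] /andP[yb by_] Xx Yy Xs Yt.
have xs x' : x <= x' <= x + s -> inX x' /\ `|x' - a| <= s.
  move=> /andP[h1 h2]; split.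
    by move: Xx Xs => /andP[? ?] /andP[? ?]; apply/andP; split; lra.
  by rewrite ler_norml; apply/andP; split; lra.
have yt y' : y <= y' <= y + t -> inY y' /\ `|y' - b| <= t.
  move=> /andP[h1 h2]; split.
    by move: Yy Yt => /andP[? ?] /andP[? ?]; apply/andP; split; lra.
  by rewrite ler_norml; apply/andP; split; lra.
have est x' y' : x <= x' <= x + s -> y <= y' <= y + t ->
    `|u x' y' - u a b - (p * (x' - a) + q * (y' - b))| <= e / 2 * (s + t) /\
    `|v x' y' - v a b - (q' * (x' - a) + p * (y' - b))| <= e / 2 * (s + t).
  move=> /xs[Xx' xa'] /yt[Yy' yb'].
  have [||h1 h2] := H x' y' Xx' Yy'; [exact: le_lt_trans sd|exact: le_lt_trans td|].
  have h3 : e / 2 * (`|x' - a| + `|y' - b|) <= e / 2 * (s + t).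
    by rewrite ler_wpM2l ?lerD// ltW.
  by split; [apply: le_trans h1 h3|apply: le_trans h2 h3].
have hor y' : y <= y' <= y + t ->
  `|A (x + s) y' - A x y' - ((v a b + p * (y' - b)) * s +
     q' * ((x + s - a) ^+ 2 - (x - a) ^+ 2) / 2)| <= e / 2 * (s + t) * s.
  move=> yy'; have := @quad_increment (fun t => A t y') (fun t => v t y')
    (v a b + p * (y' - b)) q' a (e / 2 * (s + t)) x (x + s).
  have -> : x + s - x = s by ring.
  apply; first by rewrite lerDl.
  - by move=> x' /xs[Xx' _]; apply: dA => //; have [] := yt _ yy'.
  - move=> x' xx'; have [_] := est _ _ xx' yy'.
    by congr (`| _ | <= _); ring.
have ver x' : x <= x' <= x + s ->
  `|B x' (y + t) - B x' y - ((u a b + p * (x' - a)) * t +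
     q * ((y + t - b) ^+ 2 - (y - b) ^+ 2) / 2)| <= e / 2 * (s + t) * t.
  move=> xx'; have := @quad_increment (fun t => B x' t) (fun t => u x' t)
    (u a b + p * (x' - a)) q b (e / 2 * (s + t)) y (y + t).
  have -> : y + t - y = t by ring.
  apply; first by rewrite lerDl.
  - by move=> y' /yt[Yy' _]; apply: dB => //; have [] := xs _ xx'.
  - move=> y' yy'; have [+ _] := est _ _ xx' yy'.
    by congr (`| _ | <= _); ring.
have yy : y <= y <= y + t by rewrite lexx lerDl.
have yy' : y <= y + t <= y + t by rewrite lexx lerDl t0.
have xx : x <= x <= x + s by rewrite lexx lerDl.
have xx' : x <= x + s <= x + s by rewrite lexx lerDl s0.
have := hor _ yy; have := hor _ yy'; have := ver _ xx; have := ver _ xx'.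
set h1 := A _ _ - _; set h2 := A _ _ - _; set v1 := B _ _ - _; set v2 := B _ _ - _.
rewrite !ler_norml => /andP[a1 a2] /andP[b1 b2] /andP[c1 c2] /andP[d1 d2].
have -> : I x y s t = h2 - h1 + v1 - v2 by [].
by apply/andP; split; lra.
Qed.

Let W n := w / 2 ^+ n.
Let H n := h / 2 ^+ n.

Lemma goursat_step n x y : exists z : R * R,
  [/\ z.1 = x \/ z.1 = x + W n.+1, z.2 = y \/ z.2 = y + H n.+1 &
   `|I x y (W n) (H n)| <= 4 * `|I z.1 z.2 (W n.+1) (H n.+1)|].
Proof.
set s := W n.+1; set t := H n.+1.
have Ws : W n = s + s by rewrite /s /W exprS; field; rewrite expf_neq0//.
have Ht : H n = t + t by rewrite /t /H exprS; field; rewrite expf_neq0//.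
rewrite Ws Ht.
have split4 : I x y (s + s) (t + t) =
    I x y s t + I (x + s) y s t + I x (y + t) s t + I (x + s) (y + t) s t.
  by rewrite /I !addrA; ring.
have [h1|h1] := leP (`|I x y (s + s) (t + t)|) (4 * `|I x y s t|).
  by exists (x, y); split => //; left.
have [h2|h2] := leP (`|I x y (s + s) (t + t)|) (4 * `|I (x + s) y s t|).
  by exists (x + s, y); split => //; [right|left].
have [h3|h3] := leP (`|I x y (s + s) (t + t)|) (4 * `|I x (y + t) s t|).
  by exists (x, y + t); split => //; [left|right].
have [h4|h4] := leP (`|I x y (s + s) (t + t)|) (4 * `|I (x + s) (y + t) s t|).
  by exists (x + s, y + t); split => //; right.
have := ler_normD (I x y s t + I (x + s) y s t + I x (y + t) s t) (I (x + s) (y + t) s t).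
have := ler_normD (I x y s t + I (x + s) y s t) (I x (y + t) s t).
have := ler_normD (I x y s t) (I (x + s) y s t).
rewrite -split4; lra.
Qed.

Lemma nested_limit (x : nat -> R) (l : R) : 0 <= l ->
  (forall n, x n.+1 = x n \/ x n.+1 = x n + l / 2 ^+ n.+1) ->
  exists a, forall n, x n <= a <= x n + l / 2 ^+ n.
Proof.
move=> l0 xS.
have lS n : l / 2 ^+ n = l / 2 ^+ n.+1 + l / 2 ^+ n.+1.
  by rewrite exprS; field; rewrite expf_neq0.
have lp n : 0 <= l / 2 ^+ n by rewrite divr_ge0// exprn_ge0.
have mono n k : x n <= x (n + k)%N /\ x (n + k)%N + l / 2 ^+ (n + k) <= x n + l / 2 ^+ n.
  elim: k => [|k [i1 i2]]; first by rewrite addn0 !lexx.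
  rewrite addnS; have := lS (n + k)%N; have := lp (n + k).+1.
  by case: (xS (n + k)%N) => ->; split; lra.
have le n m : x m <= x n + l / 2 ^+ n.
  have [nm|mn] := leqP n m.
    rewrite -(subnKC nm); have [_] := mono n (m - n)%N.
    by have := lp (n + (m - n))%N; lra.
  rewrite -(subnKC (ltnW mn)); have [h1 _] := mono m (n - m)%N.
  by have := lp (m + (n - m))%N; lra.
exists (sup (range x)) => n; apply/andP; split.
  apply: ub_le_sup; last by exists n.
  by exists (x n + l / 2 ^+ n) => _ [m _ <-].
apply: ge_sup; first by exists (x 0), 0.
by move=> _ [m _ <-].
Qed.

Lemma goursat : I X Y w h = 0.
Proof.
pose P (z : nat * R * R) (z' : R * R) :=
  [/\ z'.1 = z.1.2 \/ z'.1 = z.1.2 + W z.1.1.+1,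
      z'.2 = z.2 \/ z'.2 = z.2 + H z.1.1.+1 &
     `|I z.1.2 z.2 (W z.1.1) (H z.1.1)| <= 4 * `|I z'.1 z'.2 (W z.1.1.+1) (H z.1.1.+1)|].
have /choice[g gP] : forall z, exists z', P z z' by case=> -[n x] y; exact: goursat_step.
pose z := fix z n := if n is n'.+1 then g (n', (z n').1, (z n').2) else (X, Y).
have zS n := gP (n, (z n).1, (z n).2).
have [a aP] := @nested_limit (fun n => (z n).1) w w0 (fun n => let: And3 h _ _ := zS n in h).
have [b bP] := @nested_limit (fun n => (z n).2) h h0 (fun n => let: And3 _ h _ := zS n in h).
have big n : `|I X Y w h| <= 4 ^+ n * `|I (z n).1 (z n).2 (W n) (H n)|.
  elim: n => [|n IH]; first by rewrite /W /H !expr0 !divr1 mul1r.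
  apply: le_trans IH _; rewrite exprS -mulrA mulrCA ler_wpM2l ?exprn_ge0//.
  by have [_ _] := zS n.
have p2 n : 0 < 2 ^+ n :> R by exact: exprn_gt0.
have Wp n : 0 <= W n by rewrite /W divr_ge0// ltW.
have Hp n : 0 <= H n by rewrite /H divr_ge0// ltW.
have inXz n : X <= (z n).1 /\ (z n).1 + W n <= X + w.
  elim: n => [|n [i1 i2]]; first by rewrite /W expr0 divr1.
  have WS : W n = W n.+1 + W n.+1 by rewrite /W exprS; field; rewrite expf_neq0.
  have := Wp n.+1.
  by have [[] e _ _] := zS n; rewrite [(z n.+1).1]e /=; split; lra.
have inYz n : Y <= (z n).2 /\ (z n).2 + H n <= Y + h.
  elim: n => [|n [i1 i2]]; first by rewrite /H expr0 divr1.
  have HS : H n = H n.+1 + H n.+1 by rewrite /H exprS; field; rewrite expf_neq0.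
  have := Hp n.+1.
  by have [_ [] e _] := zS n; rewrite [(z n.+1).2]e /=; split; lra.
have Xa : inX a by have := aP 0%N; rewrite expr0 divr1.
have Yb : inY b by have := bP 0%N; rewrite expr0 divr1.
(* The n bisections cost a factor 4 ^ n in [big] and gain the same factor in the local estimate,
   which is quadratic in the sides. *)
have small e : 0 < e -> `|I X Y w h| <= e * (w + h) ^+ 2.
  move=> e0; have [d d0 loc] := goursat_local Xa Yb e0.
  have [n [wd hd]] : exists n, w / 2 ^+ n < d /\ h / 2 ^+ n < d.
    have wh0 : 0 <= (w + h) / d by rewrite divr_ge0 ?addr_ge0// ltW.
    exists (Num.bound ((w + h) / d)); set n := Num.bound _.
    have : (w + h) / d < 2 ^+ n.
      apply: lt_le_trans (archi_boundP wh0) _.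
      by rewrite -natrX ler_nat ltnW// ltn_expl.
    have := p2 n; move: (2 ^+ n) => p p0.
    rewrite (ltr_pdivrMr _ _ d0) mulrC => wh.
    rewrite !(ltr_pdivrMr _ _ p0).
    by split; apply: le_lt_trans wh; rewrite ?lerDl ?lerDr.
  have [Xn XWn] := inXz n; have [Yn YHn] := inYz n.
  have in1 : inX (z n).1 by have := Wp n; rewrite /inX; lra.
  have in2 : inY (z n).2 by have := Hp n; rewrite /inY; lra.
  have in3 : inX ((z n).1 + W n) by have := Wp n; rewrite /inX; lra.
  have in4 : inY ((z n).2 + H n) by have := Hp n; rewrite /inY; lra.
  have Ile := loc _ _ _ _ (Wp n) (Hp n) wd hd (aP n) (bP n) in1 in2 in3 in4.
  apply: le_trans (big n) _.
  have -> : e * (w + h) ^+ 2 = 4 ^+ n * (e * (W n + H n) ^+ 2).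
    have -> : 4 = 2 ^+ 2 :> R by rewrite expr2; ring.
    by rewrite /W /H -exprM mulnC exprM; field.
  by rewrite ler_wpM2l ?exprn_ge0.
apply/eqP; rewrite -normr_eq0 eq_le normr_ge0 andbT.
apply/ler_addgt0Pr => e e0; rewrite add0r.
have q0 : 0 < (w + h) ^+ 2 + 1 by rewrite ltr_wpDl ?sqr_ge0.
apply: le_trans (small (e / ((w + h) ^+ 2 + 1)) _) _; first by rewrite divr_gt0.
rewrite mulrAC ler_pdivrMr// ler_wpM2l ?ltW//; lra.
Qed.

End Goursat.

(** * The mean value property *)


Section MeanValue.
Context {R : realType}.
Local Notation C := R[i].
Local Notation N := (@Normc.normc R).
Local Notation re := (@complex.Re R).
Local Notation im := (@complex.Im R).
Implicit Types (z w l k c : C) (f g : C -> C) (x y s t e d r : R).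

Lemma is_derive_eps (F : R -> R) x (l : R) : is_derive x 1 F l -> forall e, 0 < e ->
  exists2 d : R, 0 < d & forall h : R, `|h| < d -> `|F (x + h) - F x - l * h| <= e * `|h|.
Proof.
move=> [dF Fl] e e0.
have : (fun h => h^-1 *: (F (h + x) - F x)) @ 0^' --> l.
  move: dF Fl; rewrite /derivable /derive.
  have -> : (fun h : R => h^-1 *: ((F \o shift x) (h *: 1) - F x)) =
            (fun h => h^-1 *: (F (h + x) - F x)).
    by apply/funext => h; rewrite /= /shift /GRing.scale /= mulr1.
  by move=> h <-.
move=> /(_ [set y | `|y - l| < e]) [].
  by apply/nbhs_ballP; exists e => //= y; rewrite /ball /= distrC.
move=> d /= d0 H; exists d => // h hd.
have [->|h0] := eqVneq h 0; first by rewrite addr0 mulr0 subrr subr0 normr0 mulr0.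
have := H h; rewrite /ball_ /= sub0r normrN => /(_ hd h0) /ltW.
rewrite [x + h]addrC /GRing.scale /= => le.
have -> : F (h + x) - F x - l * h = (h^-1 * (F (h + x) - F x) - l) * h.
  by rewrite mulrBl mulrAC mulVf// mul1r.
by rewrite normrM ler_wpM2r.
Qed.

Definition cexp z : C := (expR (re z) * cos (im z)) +i* (expR (re z) * sin (im z)).

Lemma cexpD z w : cexp (z + w) = cexp z * cexp w.
Proof.
rewrite /cexp reD imD expRD cosD sinD.
by congr (_ +i* _); ring.
Qed.

Lemma N_cexp z : N (cexp z) = expR (re z).
Proof.
apply/eqP; rewrite -(eqrXn2 (n:=2)) ?N_ge0 ?expR_ge0// N_sqr /=.
by rewrite !exprMn -mulrDr cos2Dsin2 mulr1.
Qed.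

Lemma cexp0 : cexp 0 = 1.
Proof. by rewrite /cexp /= expR0 cos0 sin0 !mul1r. Qed.

Lemma cder_cexp z : cder cexp z (cexp z).
Proof.
have d0 : forall e, 0 < e -> exists2 d, 0 < d & forall h : C, N h < d ->
    N (cexp h - 1 - h) <= e * N h.
  (* The real and imaginary errors below come to 3 e' and 4 e' times [N h], together 7 / 16 of the
     allowance. *)
  move=> e e0; pose e' := Num.min 1 e / 16.
  have e'0 : 0 < e' by rewrite divr_gt0// lt_min ltr01.
  have e'1 : e' <= 1 / 16 by rewrite ler_pM2r// ge_min lexx.
  have e'e : e' <= e / 16 by rewrite ler_pM2r// ge_min lexx orbT.
  have [d1 d10 H1] := is_derive_eps (is_derive_expR 0) e'0.
  have [d2 d20 H2] := is_derive_eps (is_derive_cos 0) e'0.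
  have [d3 d30 H3] := is_derive_eps (is_derive_sin 0) e'0.
  pose d := Num.min (Num.min d1 d2) (Num.min d3 e').
  exists d; first by rewrite !lt_min d10 d20 d30.
  move=> h; rewrite !lt_min => /andP[/andP[hd1 hd2] /andP[hd3 hde]].
  have rh := re_le_N h; have ih := im_le_N h.
  have := H1 (re h) (le_lt_trans rh hd1).
  have := H2 (im h) (le_lt_trans ih hd2).
  have := H3 (im h) (le_lt_trans ih hd3).
  rewrite !add0r expR0 cos0 sin0 oppr0 mul0r !subr0 ?addr0 !mul1r.
  move=> S3 C2 E1; apply: le_trans (N_le_ReIm _) _.
  rewrite !reB !imB /cexp /= subr0.
  have Es : `|expR (re h) - 1| <= 2 * N h.
    have -> : expR (re h) - 1 = (expR (re h) - 1 - re h) + re h by ring.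
    by apply: le_trans (ler_normD _ _) _; have := normr_ge0 (re h); nra.
  have E2 : `|expR (re h)| <= 2.
    have -> : expR (re h) = (expR (re h) - 1) + 1 by ring.
    by apply: le_trans (ler_normD _ _) _; rewrite normr1; lra.
  have A1 : `|expR (re h) * cos (im h) - 1 - re h| <= 3 * e' * N h.
    have -> : expR (re h) * cos (im h) - 1 - re h =
      expR (re h) * (cos (im h) - 1) + (expR (re h) - 1 - re h) by ring.
    apply: le_trans (ler_normD _ _) _; rewrite normrM.
    have : `|expR (re h)| * `|cos (im h) - 1| <= 2 * (e' * `|im h|) by apply: ler_pM.
    have : e' * `|im h| <= e' * N h by rewrite ler_pM2l.
    have : e' * `|re h| <= e' * N h by rewrite ler_pM2l.
    lra.
  have A2 : `|expR (re h) * sin (im h) - im h| <= 4 * e' * N h.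
    have -> : expR (re h) * sin (im h) - im h =
      expR (re h) * (sin (im h) - im h) + (expR (re h) - 1) * im h by ring.
    apply: le_trans (ler_normD _ _) _; rewrite !normrM.
        have : `|expR (re h)| * `|sin (im h) - im h| <= 2 * (e' * `|im h|) by apply: ler_pM.
    have : `|expR (re h) - 1| * `|im h| <= 2 * N h * N h by apply: ler_pM.
    have : e' * `|im h| <= e' * N h by rewrite ler_pM2l.
    have : N h * N h <= e' * N h by rewrite ler_wpM2r ?N_ge0// ltW.
    lra.
  have : e' * N h <= e / 16 * N h by rewrite ler_wpM2r ?N_ge0.
  have := mulr_ge0 (ltW e0) (N_ge0 h); lra.
apply/cderP => e e0; have Nz0 : 0 < N (cexp z) by rewrite N_cexp expR_gt0.
have [|d dp H] := d0 (e / N (cexp z)); first by rewrite divr_gt0.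
exists d => // w wd.
have -> : cexp w - cexp z - cexp z * (w - z) = cexp z * (cexp (w - z) - 1 - (w - z)).
  have -> : cexp w = cexp z * cexp (w - z) by rewrite -cexpD subrKC.
  by move: (cexp _) (cexp z) => a b; ring.
rewrite Normc.normcM mulrC -ler_pdivlMr// mulrAC; exact: H.
Qed.

Lemma contR_eps (f : R -> R) x :
  (forall e, 0 < e -> exists2 d, 0 < d & forall x', `|x' - x| < d -> `|f x' - f x| < e) ->
  continuous_at x f.
Proof.
move=> H A /nbhs_ballP[e /= e0 eA]; have [d d0 dP] := H e e0.
apply/nbhs_ballP; exists d => //= y; rewrite /ball /= distrC => /dP xy.
by apply: eA; rewrite /ball /= distrC.
Qed.

(* Around c, f is read in the logarithmic coordinate: x + i y stands for
   c + (z1 - c) * exp (x + i y). *)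
Lemma mean_value_max f c r : ctends f c (f c) ->
  (forall z, 0 < N (z - c) < r -> exists l, cder f z l) ->
  (forall z, N (z - c) < r -> re (f z) <= re (f c)) ->
  forall z, N (z - c) < r -> re (f z) = re (f c).
Proof.
move=> fc df fmax z1 z1r.
have [->//|z1c] := eqVneq z1 c.
have rho0 : 0 < N (z1 - c) by rewrite N_gt0 subr_eq0.
have [xm xm0 xmr] : exists2 xm : R, 0 < xm & forall x, x <= xm -> N (z1 - c) * expR x < r.
  pose q := (N (z1 - c) + r) / 2 / N (z1 - c).
  have q1 : 1 < q by rewrite /q ltr_pdivlMr//; lra.
  have q0 : 0 < q by rewrite (lt_trans ltr01).
  exists (ln q); first by rewrite ln_gt0.
  move=> x; rewrite -ler_expR lnK ?posrE// => xq.
  apply: le_lt_trans (ler_wpM2l (ltW rho0) xq) _.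
  rewrite /q mulrC divfK ?gt_eqF//; lra.
pose F u := f (c + (z1 - c) * cexp u).
have Fin u : re u <= xm -> 0 < N (c + (z1 - c) * cexp u - c) < r.
  by move=> uxm; rewrite addrC addKr Normc.normcM N_cexp mulr_gt0 ?expR_gt0// xmr.
have dF u : re u <= xm -> exists l, cder F u l.
  move=> uxm; have [l fl] := df _ (Fin _ uxm).
  exists (l * (0 + (z1 - c) * cexp u)); apply: (cder_comp (f := fun u => c + (z1 - c) * cexp u)) => //.
  by apply: cderD; [exact: cder_cst|apply: cderZ; exact: cder_cexp].
(* Truncating x keeps the point inside the disc, so that uu and vv are continuous for all real
   arguments, as [antiderivative] demands. Nothing changes for x <= 0. *)
pose m x := Num.min x xm.
pose uu x y := re (F (m x +i* y)).
pose vv x y := im (F (m x +i* y)).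
have mle x : m x <= xm by rewrite /m ge_min lexx orbT.
have mE x : x <= 0 -> m x = x by move=> x0; apply/min_idPl; lra.
have m_lip x x' : `|m x' - m x| <= `|x' - x|.
  rewrite /m !minEle.
  have [h1|h1] := leP x xm; have [h2|h2] := leP x' xm; rewrite ?lexx ?subrr ?normr0 ?normr_ge0//.
    by rewrite (ger0_norm (x := xm - x)) ?subr_ge0// ger0_norm; lra.
  by rewrite (ler0_norm (x := x' - xm)) ?ler0_norm; lra.
have cm : forall p q p1 q1 e, `|p1 - p| < e / 2 -> `|q1 - q| < e / 2 ->
    N ((m p1 +i* q1) - (m p +i* q)) < e.
  move=> p q p1 q1 e pe qe; apply: le_lt_trans (N_le_ReIm _) _.
  by rewrite reB imB /=; have := m_lip p p1; lra.
have cF u : re u <= xm -> ctends F u (F u) by move=> /dF[l /cder_cont].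
have cv y x : continuous_at x (fun t => vv t y).
  apply: contR_eps => e e0; have /ctendsP/(_ e e0)[d d0 H] := cF (m x +i* y) (mle x).
  exists (d / 2); first by rewrite divr_gt0.
  move=> x' xx'; rewrite /vv -imB; apply: le_lt_trans (im_le_N _) _; apply: H.
  by apply: cm => //; rewrite subrr normr0 divr_gt0.
have cu x y : continuous_at y (fun t => uu x t).
  apply: contR_eps => e e0; have /ctendsP/(_ e e0)[d d0 H] := cF (m x +i* y) (mle x).
  exists (d / 2); first by rewrite divr_gt0.
  move=> y' yy'; rewrite /uu -reB; apply: le_lt_trans (re_le_N _) _; apply: H.
  by apply: cm => //; rewrite subrr normr0 divr_gt0.
have cexp_per x : cexp (x +i* - pi) = cexp (x +i* pi).
  by rewrite /cexp /= cosN sinN sinpi oppr0.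
have B_ x : exists b, forall y, - pi <= y <= pi -> is_derive y 1 b (uu x y).
  have pp : - pi - 1 < pi + 1 :> R by have := @pi_gt0 R; lra.
  by have [b bP] := antiderivative pp (cu x); exists b => y /andP[? ?]; apply: bP; lra.
have /choice[B BP] := B_.
(* The integral over a circle does not depend on the radius. *)
have circ X : X < 0 -> B X pi - B X (- pi) = B 0 pi - B 0 (- pi).
  move=> X0.
  have A_ y : exists a, forall x, X <= x <= 0 -> is_derive x 1 a (vv x y).
    have pp : X - 1 < 0 + 1 :> R by lra.
    by have [b bP] := antiderivative pp (cv y); exists b => x /andP[? ?]; apply: bP; lra.
  have /choice[A0 A0P] := A_.
  (* By periodicity one primitive serves both horizontal sides y = - pi and y = pi. They cancel
     exactly, and only the vertical sides, which are circles around c, remain. *)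
  pose A x y := if y == pi then A0 (- pi) x else A0 y x.
  have dA x y : X <= x <= 0 -> is_derive x 1 (fun t => A t y) (vv x y).
    rewrite /A; case: eqP => [->|_] xX; last exact: A0P.
    have -> : vv x pi = vv x (- pi) by rewrite /vv /F cexp_per.
    exact: A0P.
  have := @goursat R uu vv A B X (- pi) (- X) (pi *+ 2).
  rewrite subrr [pi *+ 2]mulr2n addKr.
  have npi : - pi == pi :> R = false by apply/negP => /eqP; have := @pi_gt0 R; lra.
  rewrite /A eqxx npi subrr add0r => H; apply/esym/subr0_eq; apply: H.
  - by rewrite oppr_ge0 ltW.
  - by rewrite addr_ge0// pi_ge0.
  - by move=> x y xX _; have := dA x y xX; rewrite /A.
  - by move=> x y _ yy; apply: BP.
  move=> a b aX bY; have ma0 := mE a; have [l /cderP dl] := dF (m a +i* b) (mle a).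
  exists (re l), (- im l), (im l) => e e0; have [d d0 {}dl] := dl e e0.
  exists (d / 2); first by rewrite divr_gt0.
  move=> x y /andP[_ x0] _ xa yb; have := dl _ (cm _ _ _ _ _ xa yb).
  have -> : m x = x by apply: mE.
  have -> : m a = a by apply: mE; case/andP: aX.
  move=> le; have le2 : N ((x +i* y) - (a +i* b)) <= `|x - a| + `|y - b|.
    by apply: le_trans (N_le_ReIm _) _; rewrite reB imB.
  have {le le2} le := le_trans le (ler_wpM2l (ltW e0) le2).
  have [h1 h2] := (le_trans (re_le_N _) le, le_trans (im_le_N _) le).
  rewrite /uu /vv mE// mE//; last by case/andP: aX.
  split; [apply: le_trans h1|apply: le_trans h2]; rewrite ?reB ?imB ?reM ?imM reB imB /=.
    by rewrite le_eqVlt; apply/orP; left; apply/eqP; congr `| _ |; ring.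
  by rewrite le_eqVlt; apply/orP; left; apply/eqP; congr `| _ |; ring.
have pi0 := @pi_gt0 R.
have mvt x s t : - pi <= s -> s <= t -> t <= pi -> exists2 y : R, - pi <= y <= pi &
    B x t - B x s = uu x y * (t - s).
  move=> ps st tp; have dB y : s <= y <= t -> is_derive y 1 (B x) (uu x y).
    by move=> /andP[? ?]; apply: BP; lra.
  have [y|y yst E] := @MVT_segment R (B x) (uu x) s t st _ (is_derive_cont dB).
    by rewrite in_itv /= => /andP[/ltW sy /ltW yt]; apply: dB; rewrite sy.
  by exists y => //; move: yst; rewrite in_itv /= => /andP[? ?]; lra.
set M := re (f c) in fmax *.
(* As the radius [N (z1 - c) * q] shrinks, continuity at c forces the mean over the circle to the
   central value M. *)
have Bpi : B 0 pi - B 0 (- pi) = M * (pi - - pi).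
  apply/eqP; rewrite -subr_eq0 -normr_eq0 eq_le normr_ge0 andbT.
  apply/ler_addgt0Pr => e e0; rewrite add0r.
  have e'0 : 0 < e / (pi - - pi) by rewrite divr_gt0//; lra.
  have /ctendsP/(_ _ e'0)[d d0 H] := fc.
  pose q := Num.min 2^-1 (d / 2 / N (z1 - c)).
  have q0 : 0 < q by rewrite lt_min invr_gt0 ltr0n /= !divr_gt0.
  have q1 : q < 1 by rewrite gt_min; apply/orP; left; rewrite invf_lt1//; lra.
  have qd : N (z1 - c) * q < d.
    apply: le_lt_trans (_ : N (z1 - c) * (d / 2 / N (z1 - c)) < d).
      by rewrite ler_pM2l// ge_min lexx orbT.
    by rewrite mulrC divfK ?gt_eqF//; lra.
  have X0 : ln q < 0 by rewrite ln_lt0// q0.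
  rewrite -(circ _ X0).
  have [|||y _ ->] := mvt (ln q) (- pi) pi; [by []|lra|by []|].
  rewrite -mulrBl normrM (gtr0_norm (x := pi - - pi)); last lra.
  rewrite -ler_pdivlMr; last lra.
  rewrite /uu mE; last exact: ltW.
  rewrite -reB; apply: le_trans (re_le_N _) (ltW _); apply: H.
  by rewrite addrC addKr Normc.normcM N_cexp /= lnK ?posrE.
have mono s t : - pi <= s -> s <= t -> t <= pi -> B 0 t - B 0 s <= M * (t - s).
  move=> ps st tp; have [y yy ->] := mvt 0 s t ps st tp.
  rewrite ler_wpM2r ?subr_ge0//; apply: fmax.
  by have /andP[] := Fin (m 0 +i* y) (mle 0).
(* [B 0] has slope at most M on every piece and exactly M in total, hence M on each piece. Its
   derivative at angle 0 is the real part of f at z1. *)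
have lin h : 0 < h -> h <= pi -> B 0 h - B 0 0 = M * h.
  move=> h0 hp; apply/eqP; rewrite eq_le; apply/andP; split.
    by have := mono 0 h; rewrite subr0; apply; lra.
  have := mono (- pi) 0; have := mono h pi; lra.
have zero : - (pi : R) <= 0 <= (pi : R) by lra.
have -> : re (f z1) = uu 0 0.
  by rewrite /uu mE// /F cexp0 mulr1 subrKC.
apply/eqP; rewrite -subr_eq0 -normr_eq0 eq_le normr_ge0 andbT.
apply/ler_addgt0Pr => e e0; rewrite add0r.
have [d d0 H] := is_derive_eps (BP 0 0 zero) e0.
pose h := Num.min (d / 2) pi.
have h0 : 0 < h by rewrite lt_min divr_gt0.
have hd : h < d.
  by have : h <= d / 2 by [rewrite ge_min lexx]; lra.
have hp : h <= pi by rewrite ge_min lexx orbT.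
have := H h; rewrite gtr0_norm// => /(_ hd); rewrite add0r lin//.
by rewrite -mulrBl normrM (gtr0_norm h0) ler_pM2r// distrC.
Qed.

(** Multiplication by the conjugate of f c turns a maximum of the modulus into one of the real part.
    Once the real part is constant, equality in the Cauchy-Schwarz inequality gives f z = f c. *)
Lemma local_max_cst f c r : ctends f c (f c) ->
  (forall z, 0 < N (z - c) < r -> exists l, cder f z l) ->
  (forall z, N (z - c) < r -> N (f z) <= N (f c)) ->
  forall z, N (z - c) < r -> f z = f c.
Proof.
move=> fc df fmax z zr; pose k := (f c)^*.
have kc w : re (k * w) = re (f c) * re w + im (f c) * im w.
  by rewrite reM /k; case: (f c) w => a b [x y] /=; ring.
have Nk : N k = N (f c) by rewrite /k; case: (f c) => a b /=; rewrite sqrrN.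
have kcc : re (k * f c) = N (f c) ^+ 2 by rewrite kc N_sqr !expr2.
have : re (k * f z) = N (f c) ^+ 2.
  rewrite -kcc; apply: (mean_value_max (f := fun z => k * f z) (r := r)) => //.
  - exact: (ctendsM (ctends_cst k c) fc).
  - by move=> w /df[l fl]; exists (k * l); exact: cderZ.
  - move=> w /fmax le; rewrite kcc; apply: le_trans (le_trans (ler_norm _) (re_le_N _)) _.
    by rewrite Normc.normcM Nk expr2 ler_wpM2l ?N_ge0.
have := fmax z zr; rewrite -(ler_pXn2r (n := 2)) ?nnegrE ?N_ge0// !N_sqr kc => h1 h2.
apply/eqP; rewrite -subr_eq0 -N_eq0 -sqrf_eq0 N_sqr reB imB.
rewrite eq_le addr_ge0 ?sqr_ge0// andbT; nra.
Qed.

End MeanValue.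

(** * Maximum modulus and removable singularities *)


Section Removable.
Context {R : realType}.
Local Notation C := R[i].
Local Notation N := (@Normc.normc R).
Local Notation re := (@complex.Re R).
Local Notation im := (@complex.Im R).
Implicit Types (z w l k c a : C) (f g Q : C -> C) (x y s t e d r M rho : R).

Lemma closedCP (A : set C) :
  (forall z, (forall e, 0 < e -> exists2 w, A w & N (w - z) < e) -> A z) -> closed A.
Proof.
move=> H z zA; apply: H => e e0.
have [|w [Aw we]] := zA [set w | N (w - z) < e]; first by apply/nbhsCP; exists e.
by exists w.
Qed.

Lemma bounded_closed_compactC (A : set C) M :
  closed A -> (forall z, A z -> N z <= M) -> compact A.
Proof.
move=> cA bA; pose S : set (R * R) := `[- M, M]%classic `*` `[- M, M]%classic.
pose g (p : R * R) : C := p.1 +i* p.2.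
have cg : continuous g.
  move=> [x y] B /nbhsCP[e e0 eB].
  have e20 : 0 < e / 2 by rewrite divr_gt0.
  exists (ball x (e / 2), ball y (e / 2)).
    by split; exact: nbhsx_ballx.
  move=> [x' y'] [/= xx yy]; apply: eB; apply: le_lt_trans (N_le_ReIm _) _.
  move: xx yy; rewrite reB imB /ball /= ![`|x - _|]distrC ![`|y - _|]distrC; lra.
have cS : compact (g @` S).
  apply: continuous_compact; first exact: continuous_subspaceT.
  by apply: compact_setX; exact: segment_compact.
apply: subclosed_compact cA cS _ => z /bA zM; exists (re z, im z); last by case: (z).
have := le_trans (re_le_N z) zM; have := le_trans (im_le_N z) zM; rewrite !ler_norml => h1 h2.
by split; rewrite /= in_itv.
Qed.

Lemma EVT_C (A : set C) (u : C -> R) : compact A -> A !=set0 ->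
  (forall z, A z -> rtends u z (u z)) ->
  exists2 c, A c & forall z, A z -> u z <= u c.
Proof.
move=> cA A0 cu.
have [|c] := compact_EVT_max (f := u) A0 cA.
  apply: continuous_in_subspaceT => z; rewrite inE => Az.
  by have [] := cu z Az.
by rewrite inE => Ac H; exists c => // z Az; apply: H; rewrite inE.
Qed.

Definition cdisc c r : set C := [set z | N (z - c) <= r].

Lemma cdisc_compact c r : compact (cdisc c r).
Proof.
apply: (@bounded_closed_compactC _ (N c + r)).
  apply: closedCP => z H; rewrite /cdisc /=; apply/ler_addgt0Pr => e /H[w wr we].
  apply: le_trans (N_tri z w c) _; rewrite addrC; apply: lerD => //.
  by rewrite N_distC ltW.
by move=> z zr; rewrite -(subrK c z) addrC; apply: le_trans (le_normcD _ _) _; rewrite lerD2l.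
Qed.

Lemma seq_isolated c (E : seq C) : exists2 d, 0 < d & forall z, 0 < N (z - c) < d -> z \notin E.
Proof.
elim: E => [|a E [d d0 H]]; first by exists 1.
have [->|ac] := eqVneq a c.
  exists d => // z zd; rewrite inE negb_or H// andbT.
  by case/andP: zd; rewrite N_gt0 subr_eq0.
have ac0 : 0 < N (a - c) by rewrite N_gt0 subr_eq0.
exists (Num.min d (N (a - c))) => [|z]; first by rewrite lt_min d0.
rewrite lt_min => /and3P[z0 zd za]; rewrite inE negb_or H ?z0// andbT.
by apply: contraTneq za => ->; rewrite ltxx.
Qed.

(** The finite set E admits points where f is merely continuous. It serves divided differences,
    whose differentiability at the base point is not yet known; [local_max_cst] tolerates such a
    point at the centre. *)
Lemma maximum_modulus f c r (E : seq C) M : 0 < r ->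
  (forall z, N (z - c) <= r -> ctends f z (f z)) ->
  (forall z, N (z - c) < r -> z \notin E -> exists l, cder f z l) ->
  (forall z, N (z - c) = r -> N (f z) <= M) ->
  forall z, N (z - c) <= r -> N (f z) <= M.
Proof.
move=> r0 cf df bf.
have cNf z : cdisc c r z -> rtends (fun z => N (f z)) z (N (f z)) by move=> /cf /rtends_N.
have disc0 : cdisc c r !=set0 by exists c; rewrite /cdisc /= subrr Normc.normc0 ltW.
have [z0 z0r z0max] := EVT_C (@cdisc_compact c r) disc0 cNf.
pose A := [set z | N (z - c) <= r /\ N (f z) = N (f z0)].
have cA : compact A.
  apply: (subclosed_compact _ (@cdisc_compact c r)) => [|z []//].
  apply: closedCP => z H.
  have zr : N (z - c) <= r.
    apply/ler_addgt0Pr => e /H[w [wr _] we]; apply: le_trans (N_tri z w c) _.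
    by rewrite addrC lerD// N_distC ltW.
  split=> //; apply/eqP; rewrite -subr_eq0 -normr_eq0 eq_le normr_ge0 andbT.
  apply/ler_addgt0Pr => e e0; rewrite add0r.
  have /rtendsP/(_ e e0)[d d0 dP] := cNf z zr.
  by have [w [_ <-] /dP] := H d d0; rewrite distrC => /ltW.
(* Among the maximisers of |f|, take one that is as far from c as possible. *)
have [||z1 [z1r z1max] z1far] := EVT_C (u := fun z => N (z - c)) cA.
- by exists z0.
- by move=> z _; apply: rtends_N; exact: (ctendsB (ctends_id z) (ctends_cst c z)).
move=> z zr; apply: le_trans (z0max z zr) _; rewrite -z1max.
move: z1r; rewrite le_eqVlt => /orP[/eqP/bf//|z1r].
have [d d0 dE] := seq_isolated z1 E.
pose d' := Num.min d (r - N (z1 - c)).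
have d'0 : 0 < d' by rewrite lt_min d0 subr_gt0.
have inr w : N (w - z1) < d' -> N (w - c) < r.
  rewrite lt_min => /andP[_]; have := N_tri w z1 c; lra.
have fcst : forall w, N (w - z1) < d' -> f w = f z1.
  apply: local_max_cst; first exact/cf/ltW.
    move=> w /andP[w0 wd]; apply: df; first exact: inr.
    by apply: dE; rewrite w0 (lt_le_trans wd)// ge_min lexx.
  by move=> w /inr/ltW wr; rewrite z1max; exact: z0max.
(* A step of length d' / 2 straight away from c, in direction k, reaches a maximiser farther out
   than z1. *)
have [k k1 kz] : exists2 k, N k = 1 & N (z1 - c + (d' / 2)%:C * k) = N (z1 - c) + d' / 2.
  have [->|z1c] := eqVneq z1 c.
    exists 1; first by rewrite Normc.normc1.
    by rewrite subrr Normc.normc0 !add0r mulr1 N_real gtr0_norm ?divr_gt0.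
  have Nz : N (z1 - c) != 0 by rewrite N_eq0 subr_eq0.
  exists ((z1 - c) * (N (z1 - c))^-1%:C).
    by rewrite Normc.normcM N_real normfV ger0_norm ?N_ge0// mulfV.
  have -> : z1 - c + (d' / 2)%:C * ((z1 - c) * (N (z1 - c))^-1%:C) =
      (z1 - c) * (1 + d' / 2 / N (z1 - c))%:C.
    by rewrite !rmorphD !rmorphM rmorph1 /=; ring.
  rewrite Normc.normcM N_real ger0_norm; first by field.
  by rewrite addr_ge0// !divr_ge0 ?N_ge0// ltW.
pose z2 := z1 + (d' / 2)%:C * k.
have z2d : N (z2 - z1) < d'.
  by rewrite /z2 addrC addKr Normc.normcM k1 N_real gtr0_norm ?divr_gt0// mulr1; lra.
have : N (z2 - c) <= N (z1 - c).
  by apply: z1far; split; [exact/ltW/inr|rewrite fcst].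
by rewrite /z2 addrAC kz; lra.
Qed.

Lemma quot_cont f a Q z : (forall w, f w - f a = Q w * (w - a)) -> z != a ->
  ctends f z (f z) -> ctends Q z (Q z).
Proof.
move=> fQ za cf.
have za0 : 0 < N (z - a) by rewrite N_gt0 subr_eq0.
have QE w : w != a -> Q w = (f w - f a) * (w - a)^-1.
  by move=> wa; rewrite fQ mulfK// subr_eq0.
have near w : N (w - z) < N (z - a) -> (f w - f a) * (w - a)^-1 = Q w.
  move=> wz; rewrite QE//; apply: contraTneq wz => ->; rewrite N_distC ltxx //.
apply: (ctends_near (f := fun w => (f w - f a) * (w - a)^-1)); first by exists (N (z - a)).
rewrite QE//; apply: ctendsM; first exact: (ctendsB cf (ctends_cst _ z)).
by apply: ctendsV; [rewrite subr_eq0|exact: (ctendsB (ctends_id z) (ctends_cst _ z))].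
Qed.

Lemma quot_cder f a Q z l : (forall w, f w - f a = Q w * (w - a)) -> z != a ->
  cder f z l -> exists k, cder Q z k.
Proof.
move=> fQ za df.
have za0 : 0 < N (z - a) by rewrite N_gt0 subr_eq0.
have QE w : w != a -> Q w = (f w - f a) * (w - a)^-1.
  by move=> wa; rewrite fQ mulfK// subr_eq0.
have near w : N (w - z) < N (z - a) -> (f w - f a) * (w - a)^-1 = Q w.
  move=> wz; rewrite QE//; apply: contraTneq wz => ->; rewrite N_distC ltxx //.
have d1 := cderB df (cder_cst (f a) z).
have za' : z - a != 0 by rewrite subr_eq0.
have d2 := cderV (f := fun w => w - a) za' (cderB (cder_id z) (cder_cst a z)).
by eexists; apply: cder_near (cderM d1 d2); exists (N (z - a)).
Qed.

(** On the circle |f z - f a| <= 2 M and |z - a| > rho / 2; the maximum principle carries the bound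
    inside. The conclusion has the form of the hypotheses, with a added to E, so the estimate can be
    iterated. *)
Lemma slope_bound f c rho (E : seq C) M a Q : 0 < rho ->
  (forall z, N (z - c) <= rho -> ctends f z (f z)) ->
  (forall z, N (z - c) < rho -> z \notin E -> exists l, cder f z l) ->
  (forall z, N (z - c) = rho -> N (f z) <= M) ->
  N (a - c) < rho / 2 ->
  (forall w, f w - f a = Q w * (w - a)) -> ctends Q a (Q a) ->
  [/\ forall z, N (z - c) <= rho -> N (Q z) <= 4 * M / rho,
      forall z, N (z - c) <= rho -> ctends Q z (Q z) &
      forall z, N (z - c) < rho -> z \notin a :: E -> exists l, cder Q z l].
Proof.
move=> r0 cf df bf ar fQ cQ.
have cQ' z : N (z - c) <= rho -> ctends Q z (Q z).
  by have [->//|za /cf] := eqVneq z a; exact: quot_cont.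
have dQ z : N (z - c) < rho -> z \notin a :: E -> exists l, cder Q z l.
  rewrite inE negb_or => zr /andP[za zE]; have [l fl] := df z zr zE.
  exact: quot_cder za fl.
split=> //; apply: maximum_modulus cQ' dQ _ => // z zr.
have ar' : N (a - c) <= rho by lra.
have fa := maximum_modulus r0 cf df bf ar'.
have za : rho / 2 < N (z - a) by have := N_tri z a c; rewrite zr; lra.
have za0 : 0 < N (z - a) by lra.
have -> : Q z = (f z - f a) / (z - a).
  by rewrite fQ mulfK// -N_eq0 gt_eqF.
rewrite Normc.normcM Normc.normcV ?ler_pdivrMr//.
have h : N (f z - f a) <= 2 * M.
  by apply: le_trans (le_normcD _ _) _; rewrite normcN; have := bf z zr; lra.
apply: le_trans h _; rewrite mulrAC ler_pdivlMr//.
have M0 : 0 <= M by apply: le_trans (bf z zr); exact: N_ge0.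
nra.
Qed.

(** The intervals of radius [v a] around [u a] meet pairwise, so the supremum of their left ends
    lies in all of them. *)
Lemma cauchy_limitR (A : set C) (u : C -> R) (v : C -> R) : A !=set0 ->
  (forall a b, A a -> A b -> `|u a - u b| <= v a + v b) ->
  exists l : R, forall a, A a -> `|u a - l| <= v a.
Proof.
move=> [a0 Aa0] H; pose S := [set u a - v a | a in A].
have ub b : A b -> ubound S (u b + v b).
  by move=> Ab _ [a Aa <-]; have := H a b Aa Ab; rewrite ler_norml; lra.
exists (sup S) => a Aa; rewrite ler_norml; apply/andP; split.
  rewrite lerBrDl -lerBrDr opprK; apply: ge_sup; last exact: ub.
  by exists (u a0 - v a0), a0.
rewrite lerBlDr -lerBlDl; apply: ub_le_sup; last by exists a.
by exists (u a + v a); exact: ub.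
Qed.

Lemma cauchy_limitC (A : set C) (f : C -> C) (v : C -> R) : A !=set0 ->
  (forall a b, A a -> A b -> N (f a - f b) <= v a + v b) ->
  exists l, forall a, A a -> N (f a - l) <= 2 * v a.
Proof.
move=> A0 H.
have [|x xP] := @cauchy_limitR A (fun z => re (f z)) v A0.
  by move=> a b Aa Ab; rewrite -reB; apply: le_trans (re_le_N _) _; exact: H.
have [|y yP] := @cauchy_limitR A (fun z => im (f z)) v A0.
  by move=> a b Aa Ab; rewrite -imB; apply: le_trans (im_le_N _) _; exact: H.
exists (x +i* y) => a Aa; apply: le_trans (N_le_ReIm _) _.
by rewrite reB imB /=; have := xP a Aa; have := yP a Aa; lra.
Qed.

Definition holo f c r := forall z, N (z - c) < r -> exists l, cder f z l.

Lemma holo_cont f c r z : holo f c r -> N (z - c) < r -> ctends f z (f z).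
Proof. by move=> /(_ z) h /h[l /cder_cont]. Qed.

Lemma holo_sub f c r a s : holo f c r -> N (a - c) + s <= r -> holo f a s.
Proof. by move=> h le z zs; apply: h; have := N_tri z a c; lra. Qed.

Lemma bounded_on_cdisc f c r : 0 <= r -> (forall z, N (z - c) <= r -> ctends f z (f z)) ->
  exists2 M, 0 < M & forall z, N (z - c) <= r -> N (f z) <= M.
Proof.
move=> r0 cf.
have [|z /cf/rtends_N//|z0 _ H] := EVT_C (u := fun z => N (f z)) (@cdisc_compact c r).
  by exists c; rewrite /cdisc /= subrr Normc.normc0.
exists (N (f z0) + 1); first by rewrite ltr_wpDl ?N_ge0.
by move=> z zr; rewrite ler_wpDr// H.
Qed.

(* The second divided differences of f are bounded near c, so the slopes
   through c form a Cauchy family. *)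
Lemma removable_singularity f c r : 0 < r -> ctends f c (f c) ->
  (forall z, 0 < N (z - c) < r -> exists l, cder f z l) -> exists l, cder f c l.
Proof.
move=> r0 fc df; pose rho := r / 2; have rho0 : 0 < rho by rewrite divr_gt0.
have rhor : rho < r by rewrite /rho; lra.
have df' z : N (z - c) < rho -> z \notin [:: c] -> exists l, cder f z l.
  rewrite inE => zr zc; apply: df; rewrite N_gt0 subr_eq0 zc /=; lra.
have cf z : N (z - c) <= rho -> ctends f z (f z).
  move=> zr; have [->//|zc] := eqVneq z c.
  by have [|l /cder_cont//] := df z; rewrite N_gt0 subr_eq0 zc /=; lra.
have [M M0 fM] := bounded_on_cdisc (ltW rho0) cf.
have fM' z : N (z - c) = rho -> N (f z) <= M by move=> e; apply: fM; rewrite e.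
pose sl a b := (f a - f b) / (a - b).
(* Two uses of [slope_bound], with base points a and b other than c, bound the second divided
   differences by this. *)
pose M2 := 4 * (4 * M / rho) / rho.
have key a b : a != c -> b != c -> a != b -> N (a - c) < rho / 2 -> N (b - c) < rho / 2 ->
    N (sl a c - sl a b) <= M2 * N (b - c).
  move=> ac bc ab ar br.
  have slE Q w : (forall w, f w - f a = Q w * (w - a)) -> w != a -> sl a w = Q w.
    move=> fQ wa; rewrite /sl -(opprB (f w)) -(opprB w) fQ invrN mulrNN mulfK//.
    by rewrite subr_eq0.
  have [|la [Q [fQ Qla Ql]]] := df a; first by rewrite N_gt0 subr_eq0 ac /=; lra.
  rewrite -Qla in Ql.
  have [QM cQ dQ] := slope_bound rho0 cf df' fM' ar fQ Ql.
  have bac : b \notin [:: a; c] by rewrite !inE negb_or bc andbT eq_sym.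
  have [|lb [P [QP Plb Pl]]] := dQ b _ bac; first by lra.
  rewrite -Plb in Pl.
  have QM' z : N (z - c) = rho -> N (Q z) <= 4 * M / rho by move=> e; apply: QM; rewrite e.
  have [PM _ _] := slope_bound rho0 cQ dQ QM' br QP Pl.
  rewrite (slE Q)//; last by rewrite eq_sym.
  rewrite (slE Q)//; last by rewrite eq_sym.
  rewrite QP Normc.normcM N_distC ler_wpM2r ?N_ge0//; apply: PM.
  by rewrite subrr Normc.normc0 ltW.
pose A := [set a | 0 < N (a - c) < rho / 2].
have M20 : 0 <= M2 by rewrite /M2 !mulr_ge0 ?invr_ge0// ltW.
have A0 : A !=set0.
  exists (c + (rho / 4)%:C); rewrite /A /= addrC addKr N_real gtr0_norm; first by lra.
  by lra.
have [a b|l lP] := @cauchy_limitC A (fun a => sl a c) (fun a => M2 * N (a - c)) A0.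
  rewrite /A /= => /andP[a0 ar] /andP[b0 br].
  have [->|ab] := eqVneq a b.
    by rewrite subrr Normc.normc0; have := mulr_ge0 M20 (N_ge0 (b - c)); lra.
  have ac : a != c by move: a0; rewrite N_gt0 subr_eq0.
  have bc : b != c by move: b0; rewrite N_gt0 subr_eq0.
  have h1 := key a b ac bc ab ar br.
  have h2 : N (sl b c - sl b a) <= M2 * N (a - c) by apply: key => //; rewrite eq_sym.
  have ba : sl b a = sl a b by rewrite /sl -(opprB (f a)) -(opprB a) invrN mulrNN.
  have -> : sl a c - sl b c = (sl a c - sl a b) + (sl b a - sl b c) by rewrite ba; ring.
  by apply: le_trans (le_normcD _ _) _; rewrite (N_distC (sl b a)); lra.
exists l; apply/cderP => e e0.
pose d := Num.min (rho / 2) (e / (2 * M2 + 1)).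
have k0 : 0 < 2 * M2 + 1 by lra.
exists d => [|w]; first by rewrite lt_min !divr_gt0.
rewrite lt_min => /andP[w1 w2].
have [->|wc] := eqVneq w c; first by rewrite !subrr mulr0 subrr Normc.normc0 mulr0.
have wc0 : 0 < N (w - c) by rewrite N_gt0 subr_eq0.
have wc1 : w - c != 0 by rewrite subr_eq0.
have -> : f w - f c - l * (w - c) = (sl w c - l) * (w - c).
  by rewrite mulrBl /sl divfK.
rewrite Normc.normcM ler_wpM2r ?N_ge0//.
have Aw : A w by rewrite /A /= wc0.
apply: le_trans (lP w Aw) _.
move: w2; rewrite ltr_pdivlMr//; nra.
Qed.

(** Division by w - c stays within holomorphic functions. Iterated, it gives Taylor expansions with
    holomorphic remainder and so replaces power series. *)
Lemma holo_quot f c r : 0 < r -> holo f c r ->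
  exists2 Q, holo Q c r & forall w, f w - f c = Q w * (w - c).
Proof.
move=> r0 hf.
have [|l [Q [fQ _ Ql]]] := hf c; first by rewrite subrr Normc.normc0.
exists Q => //.
have dQ z : N (z - c) < r -> z != c -> exists l, cder Q z l.
  by move=> /hf[k fk] zc; exact: quot_cder zc fk.
move=> z zr; have [->|zc] := eqVneq z c; last exact: dQ.
apply: (removable_singularity r0); first by rewrite (ctends_unique Ql).
by move=> w /andP[w0 wr]; apply: dQ => //; rewrite -subr_eq0 -N_gt0.
Qed.

Definition cderiv f z := xget 0 (cder f z).

Lemma cderivE f z l : cder f z l -> cderiv f z = l.
Proof.
by move=> fl; apply: (cder_unique (f := f) (z := z)) => //; exact: (xgetI 0 fl).
Qed.

Lemma cderivP f z : (exists l, cder f z l) -> cder f z (cderiv f z).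
Proof. by move=> [l fl]; rewrite (cderivE fl). Qed.

(** A Cauchy estimate: the derivative at a is the value at a of the slope based at a, which
    [slope_bound] controls uniformly in a. *)
Lemma cderiv_bounded f c r : 0 < r -> holo f c r ->
  exists M, exists2 d, 0 < d & forall z, N (z - c) < d -> N (cderiv f z) <= M.
Proof.
move=> r0 hf; pose rho := r / 2; have rho0 : 0 < rho by rewrite divr_gt0.
have rhor : rho < r by rewrite /rho; lra.
have cf z : N (z - c) <= rho -> ctends f z (f z).
  by move=> zr; apply: holo_cont hf _; lra.
have df z : N (z - c) < rho -> z \notin [::] -> exists l, cder f z l.
  by move=> zr _; apply: hf; lra.
have [M M0 fM] := bounded_on_cdisc (ltW rho0) cf.
have fM' z : N (z - c) = rho -> N (f z) <= M by move=> e; apply: fM; rewrite e.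
exists (4 * M / rho), (rho / 2); first by rewrite divr_gt0.
move=> a ar; have [|l fl] := hf a; first lra.
rewrite (cderivE fl); case: fl => Q [fQ Qa Ql]; rewrite -Qa in Ql *.
by have [H _ _] := slope_bound rho0 cf df fM' ar fQ Ql; apply: H; lra.
Qed.

(** Write f w = f z0 + Q z0 (w - z0) + P w (w - z0) ^ 2. The slope of f' at z0 is then 2 P + P' (z -
    z0), and it tends to 2 P z0 because P' is bounded near z0. *)
Lemma holo_cderiv f c r : holo f c r -> holo (cderiv f) c r.
Proof.
move=> hf z0 z0r; have s0 : 0 < r - N (z0 - c) by rewrite subr_gt0.
set s := r - _ in s0; have {}hf : holo f z0 s by apply: holo_sub hf _; rewrite /s; lra.
have [Q hQ fQ] := holo_quot s0 hf; have [P hP QP] := holo_quot s0 hQ.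
have z0s : N (z0 - z0) < s by rewrite subrr Normc.normc0.
have fE w : f w = f z0 + (Q z0 * (w - z0) + P w * ((w - z0) * (w - z0))).
  by rewrite -[LHS](subrK (f z0)) fQ -[Q w](subrK (Q z0)) QP; ring.
have did z : cder (fun w => w - z0) z 1 by rewrite -[1]subr0; exact: (cderB (cder_id z) (cder_cst z0 z)).
have dfE z : N (z - z0) < s -> cderiv f z = Q z0 + (2 * P z + cderiv P z * (z - z0)) * (z - z0).
  move=> zs; apply: cderivE.
  have -> : f = (fun w => f z0 + (Q z0 * (w - z0) + P w * ((w - z0) * (w - z0)))).
    by apply/funext => w; rewrite -fE.
  have := cderD (cder_cst (f z0) z)
    (cderD (cderZ (Q z0) (did z)) (cderM (cderivP (hP z zs)) (cderM (did z) (did z)))).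
  by congr cder; ring.
exists (2 * P z0).
have dfE0 : cderiv f z0 = Q z0 by rewrite dfE// subrr mulr0 addr0.
apply: (cder_near (f := fun z => Q z0 + (2 * P z + cderiv P z * (z - z0)) * (z - z0))).
  by exists s => // w /dfE.
exists (fun z => 2 * P z + cderiv P z * (z - z0)); split.
- by move=> w; rewrite subrr mulr0; ring.
- by rewrite subrr mulr0 addr0.
have cP := holo_cont hP z0s.
rewrite -[2 * P z0]addr0; apply: ctendsD; first exact: (ctendsM (ctends_cst 2 z0) cP).
have [M [d d0 PM]] := cderiv_bounded s0 hP.
apply/ctendsP => e e0.
have M0 : 0 <= M by apply: le_trans (PM z0 _); rewrite ?N_ge0// subrr Normc.normc0.
exists (Num.min d (e / (M + 1))) => [|w]; first by rewrite lt_min d0 divr_gt0//; lra.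
rewrite lt_min subr0 Normc.normcM => /andP[/PM wd].
rewrite ltr_pdivlMr; last lra.
by have := N_ge0 (w - z0); nra.
Qed.

End Removable.

(** * Second-order expansions *)


Section Jets.
Context {R : realType}.
Local Notation C := R[i].
Local Notation N := (@Normc.normc R).
Local Notation re := (@complex.Re R).
Implicit Types (z w l k a b : C) (f g : C -> C) (u v : C -> R) (x y s t e d r c p q : R).

(* 4 c is the Laplacian of u at z. *)
Definition jet u z a b c := forall e, 0 < e -> exists2 d, 0 < d & forall k, N k < d ->
  `|u (z + k) - u z - (re (a * k) + re (b * k ^+ 2) + c * N k ^+ 2)| <= e * N k ^+ 2.

Definition taylor2 (phi : R -> R) t p q := forall e, 0 < e -> exists2 d, 0 < d &
  forall s, `|s| < d -> `|phi (t + s) - phi t - (p * s + q * s ^+ 2)| <= e * s ^+ 2.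

Lemma taylor2P (phi phi' : R -> R) t q r : 0 < r ->
  (forall s, `|s - t| < r -> is_derive s 1 phi (phi' s)) -> is_derive t 1 phi' q ->
  taylor2 phi t (phi' t) (q / 2).
Proof.
move=> r0 d1 d2 e e0; have [d d0 H] := is_derive_eps d2 e0.
exists (Num.min d r) => [|s]; first by rewrite lt_min d0.
rewrite lt_min => /andP[sd sr].
have near x E : `|x - t| <= E -> E < d -> `|phi' x - (phi' t + q * (x - t))| <= e * E.
  move=> xE Ed; have := H (x - t) (le_lt_trans xE Ed); rewrite subrKC opprD addrA => h.
  by apply: le_trans h _; rewrite ler_wpM2l// ltW.
have [s0|s0] := leP 0 s.
  have := @quad_increment R phi phi' (phi' t) q t (e * s) t (t + s).
  rewrite lerDl => /(_ s0) H2; have {H2} := H2 _ _.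
  have -> : t + s - t = s by ring.
  rewrite ger0_norm// in sd sr.
  have -> : phi' t * s + q / 2 * s ^+ 2 = phi' t * s + q * (s ^+ 2 - (t - t) ^+ 2) / 2 by field.
  rewrite expr2 mulrA; apply.
  - by move=> x /andP[? ?]; apply: d1; rewrite ger0_norm; lra.
  - by move=> x /andP[? ?]; apply: near; rewrite // ger0_norm; lra.
have := @quad_increment R phi phi' (phi' t) q t (e * - s) (t + s) t.
rewrite gerDl (ltW s0) => /(_ isT) H2; have {H2} := H2 _ _.
have -> : t - (t + s) = - s by ring.
rewrite ltr0_norm// in sd sr.
have -> : phi (t + s) - phi t - (phi' t * s + q / 2 * s ^+ 2) =
   - (phi t - phi (t + s) - (phi' t * - s + q * ((t - t) ^+ 2 - (t + s - t) ^+ 2) / 2)) by field.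
have -> : e * s ^+ 2 = e * - s * - s by ring.
rewrite normrN; apply.
- by move=> x /andP[? ?]; apply: d1; rewrite ler0_norm; lra.
- by move=> x /andP[? ?]; apply: near; rewrite // ler0_norm; lra.
Qed.

Lemma re_sqr w : re w ^+ 2 = re (w ^+ 2) / 2 + N w ^+ 2 / 2.
Proof. by rewrite N_sqr expr2 reM; field. Qed.

Lemma N_conj w : N w^* = N w.
Proof. by case: w => a b /=; rewrite sqrrN. Qed.

Lemma re_realM (x : R) w : re (x%:C * w) = x * re w.
Proof. by rewrite reM /= mul0r subr0. Qed.

(** The square of re (a k) is re (a ^ 2 k ^ 2) / 2 + |a| ^ 2 |k| ^ 2 / 2: half of the quadratic term
    of phi joins the harmonic part, the other half the Laplacian. *)
Lemma jet_comp u z a b c (phi : R -> R) p q :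
  jet u z a b c -> taylor2 phi (u z) p q ->
  jet (fun w => phi (u w)) z (p%:C * a) (p%:C * b + (q / 2)%:C * a ^+ 2) (p * c + q / 2 * N a ^+ 2).
Proof.
move=> ju tp e e0.
(* The increment of u is at most L |k|, and at most K |k| ^ 2 after removal of its linear part. Each
   of the three errors below gets a third of e. *)
pose K := N b + `|c| + 1; pose L := N a + K.
have K0 : 0 < K by rewrite /K ltr_wpDl// addr_ge0 ?N_ge0.
have L0 : 0 < L by rewrite /L ltr_wpDl// N_ge0.
pose e1 := e / 3 / (L ^+ 2 + 1); pose e2 := e / 3 / (`|p| + 1).
pose e3 := e / 3 / (2 * K * L * `|q| + 1).
have L20 : 0 < L ^+ 2 + 1 by rewrite ltr_wpDl ?sqr_ge0.
have p0 : 0 < `|p| + 1 by rewrite ltr_wpDl.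
have q0 : 0 < 2 * K * L * `|q| + 1 by rewrite ltr_wpDl// !mulr_ge0// ltW.
have e10 : 0 < e1 by rewrite !divr_gt0.
have e20 : 0 < e2 by rewrite !divr_gt0.
have e30 : 0 < e3 by rewrite !divr_gt0.
have [d1 d10 H1] := tp _ e10.
have [d2 d20 H2] := ju _ e20.
have [d3 d30 H3] := ju _ ltr01.
pose d := Num.min (Num.min d2 d3) (Num.min (Num.min 1 e3) (d1 / L)).
exists d; first by rewrite !lt_min d20 d30 ltr01 e30 divr_gt0.
move=> k; rewrite !lt_min => /and3P[/andP[kd2 kd3] /andP[k1 ke3] kd1].
pose s := u (z + k) - u z.
pose rho := s - re (a * k).
have n0 := N_ge0 k.
have rhoK : `|rho| <= K * N k ^+ 2.
  have -> : rho = (u (z + k) - u z - (re (a * k) + re (b * k ^+ 2) + c * N k ^+ 2))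
     + (re (b * k ^+ 2) + c * N k ^+ 2) by rewrite /rho /s; ring.
  apply: le_trans (ler_normD _ _) _.
  have := H3 k kd3; have := ler_normD (re (b * k ^+ 2)) (c * N k ^+ 2).
  have := re_le_N (b * k ^+ 2); rewrite Normc.normcM N_exp normrM (ger0_norm (sqr_ge0 (N k))) /K.
  lra.
have reL : `|re (a * k)| <= N a * N k by rewrite -Normc.normcM re_le_N.
have k2 : N k ^+ 2 <= N k by rewrite expr2 ler_piMr// ltW.
have sL : `|s| <= L * N k.
  have -> : s = re (a * k) + rho by rewrite /rho; ring.
  apply: le_trans (ler_normD _ _) _; rewrite /L.
  have : K * N k ^+ 2 <= K * N k by rewrite ler_pM2l.
  lra.
have sd1 : `|s| < d1.
  by apply: le_lt_trans sL _; rewrite mulrC -ltr_pdivlMr.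
have S1 := H1 s sd1; have S2 := H2 k kd2.
have us : u (z + k) = u z + s by rewrite /s; ring.
rewrite us.
have -> : phi (u z + s) - phi (u z) - (re (p%:C * a * k) +
    re ((p%:C * b + (q / 2)%:C * a ^+ 2) * k ^+ 2) + (p * c + q / 2 * N a ^+ 2) * N k ^+ 2)
  = (phi (u z + s) - phi (u z) - (p * s + q * s ^+ 2))
    + p * (u (z + k) - u z - (re (a * k) + re (b * k ^+ 2) + c * N k ^+ 2))
    + q * (rho * (s + re (a * k))).
  have e1' : re (p%:C * a * k) = p * re (a * k) by rewrite -mulrA re_realM.
  have e2' : re ((p%:C * b + (q / 2)%:C * a ^+ 2) * k ^+ 2) =
     p * re (b * k ^+ 2) + q / 2 * re ((a * k) ^+ 2).
    have -> : (p%:C * b + (q / 2)%:C * a ^+ 2) * k ^+ 2 =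
      p%:C * (b * k ^+ 2) + (q / 2)%:C * (a * k) ^+ 2 by ring.
    by rewrite reD !re_realM.
  have e3' : re (a * k) * re (a * k) = re ((a * k) ^+ 2) / 2 + N a ^+ 2 * N k ^+ 2 / 2.
    by rewrite -expr2 re_sqr Normc.normcM; ring.
  have e4' : rho * (s + re (a * k)) = s ^+ 2 - re (a * k) * re (a * k) by rewrite /rho; ring.
  by rewrite e1' e2' e4' e3' us; field.
apply: le_trans (ler_normD _ _) _; apply: le_trans (lerD (ler_normD _ _) (lexx _)) _.
rewrite !normrM.
have T1 : e1 * s ^+ 2 <= e / 3 * N k ^+ 2.
  have : s ^+ 2 <= L ^+ 2 * N k ^+ 2.
    by rewrite -exprMn -(real_normK (num_real s)) ler_pXn2r// nnegrE ?normr_ge0// mulr_ge0// ltW.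
  move=> h; apply: le_trans (ler_wpM2l (ltW e10) h) _.
  rewrite mulrA ler_wpM2r ?sqr_ge0// /e1 mulrAC ler_pdivrMr//.
  by rewrite ler_wpM2l ?divr_ge0 ?(ltW e0)// lerDl.
have T2 : `|p| * (e2 * N k ^+ 2) <= e / 3 * N k ^+ 2.
  rewrite mulrA ler_wpM2r ?sqr_ge0// /e2 mulrA ler_pdivrMr// mulrC.
  by rewrite ler_wpM2l ?divr_ge0 ?(ltW e0)// lerDl.
have T3 : `|q| * (`|rho| * `|s + re (a * k)|) <= e / 3 * N k ^+ 2.
  have h : `|s + re (a * k)| <= 2 * L * N k.
    apply: le_trans (ler_normD _ _) _; have := mulr_ge0 (ltW K0) n0; rewrite /L in sL *; lra.
  have {}h : `|rho| * `|s + re (a * k)| <= (K * N k ^+ 2) * (2 * L * N k) by apply: ler_pM.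
  apply: le_trans (ler_wpM2l (normr_ge0 q) h) _.
  have -> : `|q| * (K * N k ^+ 2 * (2 * L * N k)) = (2 * K * L * `|q|) * N k * N k ^+ 2 by ring.
  rewrite ler_wpM2r ?sqr_ge0//.
  move: ke3; rewrite /e3 ltr_pdivlMr// => ke3.
  by have := n0; lra.
have T4 : `|p| * `|u (z + k) - u z - (re (a * k) + re (b * k ^+ 2) + c * N k ^+ 2)| <= e / 3 * N k ^+ 2.
  by apply: le_trans T2; rewrite ler_wpM2l.
lra.
Qed.

Lemma jetD u v z a b c a' b' c' : jet u z a b c -> jet v z a' b' c' ->
  jet (fun w => u w + v w) z (a + a') (b + b') (c + c').
Proof.
move=> ju jv e e0; have e20 : 0 < e / 2 by rewrite divr_gt0.
have [d d0 H] := ju _ e20; have [d' d'0 H'] := jv _ e20.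
exists (Num.min d d') => [|k]; first by rewrite lt_min d0.
rewrite lt_min => /andP[/H h /H' h'].
have -> : u (z + k) + v (z + k) - (u z + v z) - (re ((a + a') * k) +
    re ((b + b') * k ^+ 2) + (c + c') * N k ^+ 2) =
  (u (z + k) - u z - (re (a * k) + re (b * k ^+ 2) + c * N k ^+ 2)) +
  (v (z + k) - v z - (re (a' * k) + re (b' * k ^+ 2) + c' * N k ^+ 2)).
  by rewrite !mulrDl !reD; ring.
by apply: le_trans (ler_normD _ _) _; lra.
Qed.

Lemma jet_cst (x : R) z : jet (fun=> x) z 0 0 0.
Proof.
move=> e e0; exists 1 => // k _.
by rewrite !mul0r !addr0 !subrr normr0 mulr_ge0 ?sqr_ge0// ltW.
Qed.

(** Summed over the four directions h, - h, i h and - i h, the a and b terms cancel and 4 c h ^ 2 <=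
    4 e h ^ 2 remains. *)
Lemma jet_max u z a b c : jet u z a b c ->
  (exists2 d, 0 < d & forall w, N (w - z) < d -> u w <= u z) -> c <= 0.
Proof.
move=> ju [d d0 umax]; apply/ler_addgt0Pr => e e0; rewrite add0r.
have [d' d'0 H] := ju e e0; pose h := Num.min d d' / 2.
have h0 : 0 < h by rewrite divr_gt0// lt_min d0.
have hd : h < Num.min d d' by rewrite /h; have : 0 < Num.min d d' by [rewrite lt_min d0]; lra.
move: hd; rewrite lt_min => /andP[hd hd'].
have key k : N k = h -> re (a * k) + re (b * k ^+ 2) + c * h ^+ 2 <= e * h ^+ 2.
  move=> kh; have := H k; rewrite kh => /(_ hd'); rewrite ler_norml => /andP[h1 _].
  have e' : z + k - z = k by ring.
  by have := umax (z + k); rewrite e' kh => /(_ hd); lra.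
have k1 := key h%:C; rewrite N_real gtr0_norm// in k1.
have k2 := key (- h%:C); rewrite normcN N_real gtr0_norm// in k2.
have k3 := key (0 +i* h); have k4 := key (0 +i* - h).
have N3 : N (0 +i* h) = h by rewrite /= expr0n add0r sqrtr_sqr gtr0_norm.
have N4 : N (0 +i* - h) = h by rewrite /= expr0n add0r sqrrN sqrtr_sqr gtr0_norm.
have := k1 erefl; have := k2 erefl; have := k3 N3; have := k4 N4.
rewrite !expr2 !reM !imM /=.
have hh : 0 < h * h by rewrite mulr_gt0.
move=> a1 a2 a3 a4; rewrite -(ler_pM2r hh).
move: a1 a2 a3 a4; rewrite !(mulr0, mul0r, subr0, sub0r, addr0, add0r, mulrN, mulNr, opprK, oppr0); lra.
Qed.

(** Expand f (z + k) as f z + f' k + P k ^ 2. The coefficient b may stay existential, since harmonic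
    terms drop out in [jet_max]. *)
Lemma jet_normsq f z r : 0 < r -> holo f z r ->
  exists b, jet (fun w => N (f w) ^+ 2) z (2 * (f z)^* * cderiv f z) b (N (cderiv f z) ^+ 2).
Proof.
move=> r0 hf; have zr : N (z - z) < r by rewrite subrr Normc.normc0.
have [Q hQ fQ] := holo_quot r0 hf; have [P hP QP] := holo_quot r0 hQ.
have Qz : Q z = cderiv f z.
  by apply/esym/cderivE; exists Q; split => //; exact: holo_cont hQ zr.
have cP := holo_cont hP zr.
have fE k : f (z + k) = f z + (cderiv f z * k + P (z + k) * k ^+ 2).
  have e : z + k - z = k by ring.
  rewrite -[LHS](subrK (f z)) fQ e -[Q _](subrK (Q z)) QP e Qz; ring.
exists (2 * (f z)^* * P z) => e e0.
pose M := N (P z) + 1; pose A := N (f z); pose B := N (cderiv f z).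
have A0 : 0 <= A := N_ge0 _.
have B0 : 0 <= B := N_ge0 _.
have M0 : 0 < M by rewrite /M ltr_wpDl ?N_ge0.
have e10 : 0 < e / 3 / (2 * A + 1) by rewrite !divr_gt0//; lra.
have [d1 d10 H1] := (ctendsP _ _ _).1 cP _ e10.
have [d2 d20 H2] := (ctendsP _ _ _).1 cP _ ltr01.
pose e3 := e / 3 / (2 * B * M + 1); pose e4 := e / 3 / (M ^+ 2 + 1).
have B1 : 0 < 2 * B * M + 1 by have := mulr_ge0 B0 (ltW M0); lra.
have M1 : 0 < M ^+ 2 + 1 by rewrite ltr_wpDl ?sqr_ge0.
pose d := Num.min (Num.min d1 d2) (Num.min (Num.min 1 e3) e4).
exists d; first by rewrite !lt_min d10 d20 ltr01 !divr_gt0.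
move=> k; rewrite !lt_min => /and3P[/andP[kd1 kd2] /andP[k1 ke3] ke4].
have e' : z + k - z = k by ring.
have := H1 (z + k); rewrite e' => /(_ kd1) P1.
have := H2 (z + k); rewrite e' => /(_ kd2) P2.
have PM : N (P (z + k)) <= M.
  by have := N_sub_le (P (z + k)) (P z); rewrite /M; lra.
set Pk := P (z + k) in P1 P2 PM *.
have n0 := N_ge0 k.
have sq (x y : C) : N (x + y) ^+ 2 = N x ^+ 2 + 2 * re (x^* * y) + N y ^+ 2.
  by rewrite !N_sqr reM reD imD; case: x y => [? ?] [? ?] /=; ring.
have -> : N (f (z + k)) ^+ 2 - N (f z) ^+ 2 - (re (2 * (f z)^* * cderiv f z * k) +
    re (2 * (f z)^* * P z * k ^+ 2) + N (cderiv f z) ^+ 2 * N k ^+ 2) =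
  2 * re ((f z)^* * ((Pk - P z) * k ^+ 2)) + 2 * re ((cderiv f z * k)^* * (Pk * k ^+ 2))
   + N (Pk * k ^+ 2) ^+ 2.
  rewrite fE sq (sq (cderiv f z * k)) mulrDr reD Normc.normcM mulrBl mulrBr reB.
  have e1 w : re (2 * (f z)^* * w) = 2 * re ((f z)^* * w).
    by rewrite -mulrA reM /= addr0 mul0r subr0.
  rewrite -[2 * (f z)^* * cderiv f z * k]mulrA -[2 * (f z)^* * P z * _]mulrA !e1 exprMn; ring.
have r1 : `|2 * re ((f z)^* * ((Pk - P z) * k ^+ 2))| <= e / 3 * N k ^+ 2.
  rewrite normrM ger0_norm//; have := re_le_N ((f z)^* * ((Pk - P z) * k ^+ 2)).
  rewrite !Normc.normcM -expr2.
  rewrite N_conj -/A.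
  move: P1; rewrite ltr_pdivlMr; last lra.
  move=> P1 h; have k20 := sqr_ge0 (N k).
  have h2 : A * (N (Pk - P z) * N k ^+ 2) * 2 <= e / 3 * N k ^+ 2.
    have -> : A * (N (Pk - P z) * N k ^+ 2) * 2 = (A * N (Pk - P z) * 2) * N k ^+ 2 by ring.
    by rewrite ler_wpM2r//; have := N_ge0 (Pk - P z); lra.
  lra.
have r2 : `|2 * re ((cderiv f z * k)^* * (Pk * k ^+ 2))| <= e / 3 * N k ^+ 2.
  rewrite normrM ger0_norm//; have := re_le_N ((cderiv f z * k)^* * (Pk * k ^+ 2)).
  rewrite Normc.normcM N_conj !Normc.normcM -expr2 -/B.
  move: ke3; rewrite ltr_pdivlMr// => ke3 h.
  have h2 : B * N k * (N Pk * N k ^+ 2) * 2 <= e / 3 * N k ^+ 2.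
    have -> : B * N k * (N Pk * N k ^+ 2) * 2 = (2 * B * N k * N Pk) * N k ^+ 2 by ring.
    rewrite ler_wpM2r ?sqr_ge0//.
    have : 2 * B * N k * N Pk <= 2 * B * N k * M by rewrite ler_wpM2l// !mulr_ge0.
    lra.
  lra.
have r3 : `|N (Pk * k ^+ 2) ^+ 2| <= e / 3 * N k ^+ 2.
  rewrite ger0_norm ?sqr_ge0// Normc.normcM N_exp.
  move: ke4; rewrite ltr_pdivlMr// => ke4.
  have -> : (N Pk * N k ^+ 2) ^+ 2 = (N Pk ^+ 2 * N k ^+ 2) * N k ^+ 2 by ring.
  rewrite ler_wpM2r ?sqr_ge0//.
  have h1 : N Pk ^+ 2 <= M ^+ 2 by rewrite ler_pXn2r// nnegrE ?N_ge0// ltW.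
  have h2 : N k ^+ 2 <= N k by rewrite expr2 ler_piMr// ltW.
  have : N Pk ^+ 2 * N k ^+ 2 <= M ^+ 2 * N k by apply: ler_pM; rewrite ?sqr_ge0.
  lra.
apply: le_trans (ler_normD _ _) _.
apply: le_trans (lerD (ler_normD _ _) (lexx _)) _; lra.
Qed.

End Jets.

(** * Ahlfors' lemma *)


Section Ahlfors.
Context {R : realType}.
Local Notation C := R[i].
Local Notation N := (@Normc.normc R).
Implicit Types (z w l k a b : C) (f g : C -> C) (u v : C -> R) (x y s t e d r c p q rho : R).

Lemma rtendsM u v z x y : rtends u z x -> rtends v z y -> rtends (fun w => u w * v w) z (x * y).
Proof. by move=> [ux] [vy]; constructor; exact: (@cvgM _ _ (nbhs z) _ u v x y ux vy). Qed.

Lemma rtends_comp (phi : R -> R) u z x :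
  rtends u z x -> continuous_at x phi -> rtends (fun w => phi (u w)) z (phi x).
Proof. by move=> [ux] cphi; constructor; apply: (cvg_comp _ _ ux cphi). Qed.

Lemma rtends_sqr u z x : rtends u z x -> rtends (fun w => u w ^+ 2) z (x ^+ 2).
Proof. by move=> ux; rewrite expr2; under eq_fun do rewrite expr2; exact: rtendsM. Qed.

Lemma taylor2_ln t : 0 < t -> taylor2 (@ln R) t t^-1 (- (t ^+ 2)^-1 / 2).
Proof.
move=> t0; apply: (@taylor2P R (@ln R) (fun s => s^-1) t _ t) => // [s st|].
  by apply: is_derive1_ln; move: st; rewrite ltr_norml; lra.
apply: is_derive_eq; first by apply: is_deriveV; rewrite gt_eqF.
by rewrite /GRing.scale /= mulr1.
Qed.

Lemma taylor2_reflect (phi : R -> R) x t p q :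
  taylor2 phi (x - t) p q -> taylor2 (fun s => phi (x - s)) t (- p) q.
Proof.
move=> H e /H[d d0 {}H]; exists d => // s sd.
have := H (- s); rewrite normrN => /(_ sd); rewrite sqrrN mulrN mulNr.
by have -> : x - (t + s) = x - t - s by ring.
Qed.

Lemma N2 : N 2 = 2.
Proof. by have -> : 2 = (2 : R)%:C :> C by [rewrite rmorph_nat]; rewrite N_real ger0_norm. Qed.

(** ln |f| ^ 2 is harmonic off the zeros of f. The size of its linear coefficient is recorded
    because [jet_log_pole] composes it with a nonlinear function. *)
Lemma jet_ln_normsq f z r : 0 < r -> holo f z r -> f z != 0 ->
  exists a b, jet (fun w => ln (N (f w) ^+ 2)) z a b 0 /\
    N a ^+ 2 = 4 * N (cderiv f z) ^+ 2 / N (f z) ^+ 2.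
Proof.
move=> r0 hf fz0; have [b jf] := jet_normsq r0 hf.
have t0 : 0 < N (f z) ^+ 2 by rewrite exprn_gt0// N_gt0.
have Nf0 : N (f z) != 0 by rewrite N_eq0.
have := jet_comp jf (taylor2_ln t0).
set a := _%:C * _; set b' := _ + _; set c' := _ + _ => j.
have c0 : c' = 0.
  rewrite /c' !Normc.normcM N_conj N2.
  by field.
rewrite c0 in j; exists a, b'; split => //.
rewrite /a !Normc.normcM N_conj N2 N_real ger0_norm.
  by field.
by rewrite invr_ge0 ltW.
Qed.

Lemma jet_ln_disc f z r rho : 0 < r -> holo f z r -> N (f z) < rho ->
  exists a b, jet (fun w => ln (rho ^+ 2 - N (f w) ^+ 2)) z a b
    (- (rho ^+ 2 * N (cderiv f z) ^+ 2 / (rho ^+ 2 - N (f z) ^+ 2) ^+ 2)).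
Proof.
move=> r0 hf fz; have [b jf] := jet_normsq r0 hf.
have t0 : 0 < rho ^+ 2 - N (f z) ^+ 2.
  by rewrite subr_gt0 ltr_pXn2r// nnegrE ?N_ge0//; apply: ltW (le_lt_trans (N_ge0 _) fz).
have := jet_comp jf (taylor2_reflect (taylor2_ln t0)).
set a := _%:C * _; set b' := _ + _; set c' := _ + _ => j.
have c0 : c' = (- (rho ^+ 2 * N (cderiv f z) ^+ 2 / (rho ^+ 2 - N (f z) ^+ 2) ^+ 2)).
  rewrite /c' !Normc.normcM N_conj N2.
  by field; rewrite gt_eqF.
by rewrite c0 in j; exists a, b'.
Qed.

(* exp v is the square of the density of a metric near w0; the condition says
   that its curvature at w0 is at most -4, tested on holomorphic curves. *)
Definition subhyp v w0 := forall f z r, 0 < r -> holo f z r -> f z = w0 -> cderiv f z != 0 ->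
  exists a b c, jet (fun w => v (f w)) z a b c /\
    2 * N (cderiv f z) ^+ 2 * expR (v w0) <= c.

(** At the maximum, the logarithm of the product has Laplacian coefficient 0 - 2 r ^ 2 / (r ^ 2 -
    |z| ^ 2) ^ 2 + c <= 0. The 0 comes from the harmonic ln |f'| ^ 2, and [subhyp] bounds c from
    below. *)
Lemma ahlfors_critical f v z r d : 0 < d -> holo f z d -> cderiv f z != 0 -> N z < r ->
  subhyp v (f z) ->
  (forall w, N (w - z) < d ->
    N (cderiv f w) ^+ 2 * (r ^+ 2 - N w ^+ 2) ^+ 2 * expR (v (f w)) <=
    N (cderiv f z) ^+ 2 * (r ^+ 2 - N z ^+ 2) ^+ 2 * expR (v (f z))) ->
  N (cderiv f z) ^+ 2 * (r ^+ 2 - N z ^+ 2) ^+ 2 * expR (v (f z)) <= r ^+ 2.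
Proof.
move=> d0 hf f'0 zr sv umax.
have [a [b [c [jv cle]]]] := sv f z d d0 hf erefl f'0.
have hf' := holo_cderiv hf.
have [a1 [b1 [j1 _]]] := jet_ln_normsq d0 hf' f'0.
have hid : holo id z d by move=> w _; exists 1; exact: cder_id.
have [a2 [b2 j2]] := jet_ln_disc d0 hid zr.
rewrite (cderivE (cder_id z)) Normc.normc1 expr1n mulr1 in j2.
have j := jetD (jetD (jetD j1 j2) j2) jv.
have dpos (w : C) : N w < r -> 0 < r ^+ 2 - N w ^+ 2.
  by move=> tr; rewrite subr_gt0 ltr_pXn2r// nnegrE ?N_ge0//; apply: ltW (le_lt_trans (N_ge0 _) tr).
have [d1 d10 f'ne] : exists2 d1, 0 < d1 & forall w, N (w - z) < d1 -> cderiv f w != 0.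
  have zd : N (z - z) < d by rewrite subrr Normc.normc0.
  have [l /cder_cont/ctendsP/(_ (N (cderiv f z)))] := hf' z zd; rewrite N_gt0 => /(_ f'0)[d1 d10 H].
  by exists d1 => // w /H; apply: contraTneq => ->; rewrite add0r normcN ltxx.
have c_le0 := jet_max j.
have {c_le0} : 0 + - (r ^+ 2 / (r ^+ 2 - N z ^+ 2) ^+ 2) +
    - (r ^+ 2 / (r ^+ 2 - N z ^+ 2) ^+ 2) + c <= 0.
  apply: c_le0; exists (Num.min (Num.min d d1) (r - N z)).
    by rewrite !lt_min d0 d10 subr_gt0.
  move=> w; rewrite !lt_min => /andP[/andP[wd wd1] wr].
  have wr' : N w < r by have := N_tri w z 0; rewrite !subr0; lra.
  have w1 : 0 < N (cderiv f w) ^+ 2 by rewrite exprn_gt0// N_gt0 f'ne.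
  have z1 : 0 < N (cderiv f z) ^+ 2 by rewrite exprn_gt0// N_gt0.
  have w2 := dpos w wr'; have z2 := dpos z zr.
  rewrite -ler_expR !expRD !lnK ?posrE//.
  by have := umax w wd; rewrite !expr2 !mulrA.
have z2 := dpos z zr.
have D0 : 0 < (r ^+ 2 - N z ^+ 2) ^+ 2 by rewrite exprn_gt0.
move=> h; have : 2 * N (cderiv f z) ^+ 2 * expR (v (f z)) <= 2 * (r ^+ 2 / (r ^+ 2 - N z ^+ 2) ^+ 2).
  by lra.
rewrite -mulrA ler_pM2l// ler_pdivlMr// => le.
by rewrite mulrAC.
Qed.

(** The comparison is confined to points mapped into the closed set F; where curvature is not
    controlled, the inequality is assumed outright, as a boundary condition. Replacing r by rho < r
    makes the product vanish on |z| = rho and attain its maximum on a compact set. *)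
Lemma ahlfors f r (F : set C) v : 0 < r -> holo f 0 r -> closed F ->
  (forall z, N z < r -> F (f z) -> rtends v (f z) (v (f z))) ->
  (forall z, N z < r -> F (f z) ->
     N (cderiv f z) ^+ 2 * (r ^+ 2 - N z ^+ 2) ^+ 2 * expR (v (f z)) <= r ^+ 2 \/
     (nbhs (f z) F /\ subhyp v (f z))) ->
  forall z, N z < r -> F (f z) ->
    N (cderiv f z) ^+ 2 * (r ^+ 2 - N z ^+ 2) ^+ 2 * expR (v (f z)) <= r ^+ 2.
Proof.
move=> r0 hf cF cv H.
have hf' z : N z < r -> N (z - 0) < r by rewrite subr0.
have cf z : N z < r -> ctends f z (f z) by move=> /hf'; exact: holo_cont.
have cf' z : N z < r -> ctends (cderiv f) z (cderiv f z).
  by move=> /hf' zr; exact: holo_cont (holo_cderiv hf) zr.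
have main rho : 0 < rho < r -> forall z, N z < rho -> F (f z) ->
    N (cderiv f z) ^+ 2 * (rho ^+ 2 - N z ^+ 2) ^+ 2 * expR (v (f z)) <= rho ^+ 2.
  move=> /andP[rho0 rhor] z zrho Fz.
  pose u w := N (cderiv f w) ^+ 2 * (rho ^+ 2 - N w ^+ 2) ^+ 2 * expR (v (f w)).
  pose A := [set w | N w <= rho /\ F (f w)].
  have cA : compact A.
    apply: (subclosed_compact _ (@cdisc_compact R 0 rho)); last first.
      by move=> w []; rewrite /cdisc /= subr0.
    apply: closedCP => w Hw.
    have wrho : N w <= rho.
      apply/ler_addgt0Pr => e /Hw[w' [w'r _] we]; have := N_tri w w' 0.
      by rewrite !subr0 (N_distC w); lra.
    split=> //; apply: cF => B /nbhsCP[e e0 eB].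
    have /ctendsP/(_ e e0)[d d0 dP] := cf w (le_lt_trans wrho rhor).
    by have [w' [_ Fw'] /dP w'w] := Hw d d0; exists (f w'); split => //; exact: eB.
  have cu w : A w -> rtends u w (u w).
    move=> [wr Fw]; have wr' := le_lt_trans wr rhor.
    apply: rtendsM; first apply: rtendsM.
    - by apply: rtends_sqr; apply: rtends_N; exact: cf'.
    - apply: rtends_sqr; apply: (@rtends_comp (fun x => rho ^+ 2 - x) (fun w => N w ^+ 2)).
        by apply: rtends_sqr; exact: rtends_normc.
      apply: contR_eps => e e0; exists e => // x h.
      by have -> : rho ^+ 2 - x - (rho ^+ 2 - N w ^+ 2) = - (x - N w ^+ 2) by [ring]; rewrite normrN.
    - apply: (@rtends_comp (@expR R) (fun w => v (f w))); last exact: continuous_expR.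
      by apply: (ctends_rcomp (cf w wr')); exact: cv.
  have [|z0 [z0r Fz0] z0max] := EVT_C cA _ cu; first by exists z; split => //; exact: ltW.
  have uz : u z <= u z0 by apply: z0max; split => //; exact: ltW.
  apply: le_trans uz _.
  have z0r' := le_lt_trans z0r rhor.
  have [alt|[nF sv]] := H z0 z0r' Fz0.
    (* (q - t) ^ 2 / q increases with q > t, so the inequality assumed for r implies the one for
       rho. *)
    have t0 := sqr_ge0 (N z0).
    have tr : N z0 ^+ 2 <= rho ^+ 2 by rewrite ler_pXn2r// nnegrE ?N_ge0// ltW.
    have rr : rho ^+ 2 < r ^+ 2 by rewrite ltr_pXn2r// nnegrE ltW.
    have p0 : 0 < rho ^+ 2 by rewrite exprn_gt0.
    have X0 : 0 <= N (cderiv f z0) ^+ 2 * expR (v (f z0)) by rewrite mulr_ge0 ?sqr_ge0 ?expR_ge0.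
    have E q : N (cderiv f z0) ^+ 2 * (q - N z0 ^+ 2) ^+ 2 * expR (v (f z0)) =
        (N (cderiv f z0) ^+ 2 * expR (v (f z0))) * (q - N z0 ^+ 2) ^+ 2 by rewrite mulrAC.
    rewrite /u E; move: alt; rewrite E.
    move: X0 t0 tr rr p0; move: (_ * expR _) (N z0 ^+ 2) (rho ^+ 2) (r ^+ 2) => X t p q.
    move=> X0 t0 tp pq p0 le.
    have q0 : 0 < q by lra.
    have le2 : (p - t) ^+ 2 * q <= (q - t) ^+ 2 * p.
      rewrite -subr_ge0.
      have -> : (q - t) ^+ 2 * p - (p - t) ^+ 2 * q = (q - p) * (p * q - t ^+ 2) by ring.
      by rewrite mulr_ge0//; nra.
    rewrite -(ler_pM2r q0) -mulrA.
    by apply: le_trans (ler_wpM2l X0 le2) _; rewrite mulrA [leRHS]mulrC ler_pM2r.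
  have [f'0|f'0] := eqVneq (cderiv f z0) 0.
    by rewrite /u f'0 Normc.normc0 expr0n /= !mul0r sqr_ge0.
  move: z0r; rewrite le_eqVlt => /orP[/eqP z0rho|z0rho].
    by rewrite /u z0rho subrr expr0n /= mulr0 mul0r sqr_ge0.
  have [e e0 eF] := (nbhsCP _ _).1 nF.
  have /ctendsP/(_ e e0)[d d0 dP] := cf z0 z0r'.
  pose d' := Num.min d (rho - N z0).
  have d'0 : 0 < d' by rewrite lt_min d0 subr_gt0.
  apply: (@ahlfors_critical f v z0 rho d') => //.
    apply: holo_sub hf _; rewrite subr0.
    have : d' <= rho - N z0 by rewrite ge_min lexx orbT.
    by lra.
  move=> w; rewrite lt_min => /andP[wd wr]; apply: z0max; split; last exact/eF/dP.
  by have := N_tri w z0 0; rewrite !subr0; lra.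
move=> z zr Fz; set X := N (cderiv f z) ^+ 2 * expR (v (f z)).
have X0 : 0 <= X by rewrite mulr_ge0 ?sqr_ge0 ?expR_ge0.
rewrite mulrAC -/X.
have z0 := N_ge0 z.
have key rho : N z < rho -> rho < r -> X * (rho ^+ 2 - N z ^+ 2) ^+ 2 <= rho ^+ 2.
  by move=> h1 h2; rewrite /X mulrAC; apply: main => //; rewrite h2 (le_lt_trans z0).
have zr2 : N z ^+ 2 < r ^+ 2 by rewrite ltr_pXn2r// nnegrE ltW.
apply/ler_addgt0Pr => e e0.
pose A := r ^+ 2 - N z ^+ 2.
have A0 : 0 < A by rewrite subr_gt0.
(* The limit rho -> r made quantitative: passing from r - h to r changes the left side by at most X
   * 2 r h * 2 A <= h K. *)
pose K := 4 * X * A * r + 1.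
have K0 : 0 < K by rewrite /K; have := mulr_ge0 (mulr_ge0 X0 (ltW A0)) (ltW r0); lra.
pose h := Num.min ((r - N z) / 2) (e / K).
have h0 : 0 < h by rewrite lt_min !divr_gt0// subr_gt0.
have h1 : h <= (r - N z) / 2 by rewrite ge_min lexx.
have h2 : h * K <= e by rewrite -ler_pdivlMr// ge_min lexx orbT.
have [le1 le2] : N z < r - h /\ r - h < r by lra.
have le := key (r - h) le1 le2.
have -> : X * A ^+ 2 = X * ((r - h) ^+ 2 - N z ^+ 2) ^+ 2 +
    X * ((r ^+ 2 - (r - h) ^+ 2) * (A + ((r - h) ^+ 2 - N z ^+ 2))) by rewrite /A; ring.
apply: lerD => //; first by apply: le_trans le _; rewrite ler_pXn2r// ?nnegrE; lra.
apply: le_trans h2; apply: le_trans (_ : X * ((2 * r * h) * (2 * A)) <= _); last first.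
  by rewrite /K; have := h0; lra.
have B0 : 0 < (r - h) ^+ 2 - N z ^+ 2 by rewrite subr_gt0 ltr_pXn2r// nnegrE; lra.
have BA : (r - h) ^+ 2 - N z ^+ 2 <= A.
  by rewrite lerB// ler_pXn2r// ?nnegrE; lra.
rewrite ler_wpM2l// ler_pM//.
- by rewrite subr_ge0 ler_pXn2r// ?nnegrE; lra.
- by rewrite addr_ge0// ltW.
- have -> : r ^+ 2 - (r - h) ^+ 2 = 2 * r * h - h ^+ 2 by ring.
  by rewrite gerBl sqr_ge0.
- by lra.
Qed.

End Ahlfors.

(** * Explicit metrics *)


Section Metrics.
Context {R : realType}.
Local Notation C := R[i].
Local Notation N := (@Normc.normc R).
Local Notation re := (@complex.Re R).
Implicit Types (z w l k a b : C) (f g : C -> C) (u v : C -> R) (x y s t e d r c p q rho : R).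

Lemma rtendsD u v z x y : rtends u z x -> rtends v z y -> rtends (fun w => u w + v w) z (x + y).
Proof. by move=> [ux] [vy]; constructor; exact: (@cvgD _ _ _ (nbhs z) _ u v x y ux vy). Qed.

Lemma rtends_cst x z : rtends (fun=> x) z x.
Proof. by constructor; exact: (@cst_continuous C R x z). Qed.

Lemma jetZ u z a b c x : jet u z a b c ->
  jet (fun w => x * u w) z (x%:C * a) (x%:C * b) (x * c).
Proof.
move=> ju e e0; have e10 : 0 < e / (`|x| + 1) by rewrite divr_gt0// ltr_wpDl.
have [d d0 H] := ju _ e10; exists d => // k /H h.
have -> : x * u (z + k) - x * u z - (re (x%:C * a * k) + re (x%:C * b * k ^+ 2) +
    x * c * N k ^+ 2) =
    x * (u (z + k) - u z - (re (a * k) + re (b * k ^+ 2) + c * N k ^+ 2)).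
  by rewrite -!(mulrA x%:C) !re_realM; ring.
rewrite normrM; apply: le_trans (ler_wpM2l (normr_ge0 x) h) _.
rewrite mulrA ler_wpM2r ?sqr_ge0// mulrA ler_pdivrMr ?ltr_wpDl// mulrC.
by rewrite ler_wpM2l ?(ltW e0)//; lra.
Qed.

(** Logarithm of the squared density of the disc of radius rho, the form in which [subhyp] takes
    metrics. *)
Definition log_disc_metric rho w : R := ln (rho ^+ 2) + - 2 * ln (rho ^+ 2 - N w ^+ 2).

Lemma disc_pos rho w : N w < rho -> 0 < rho ^+ 2 - N w ^+ 2.
Proof.
move=> wr; rewrite subr_gt0 ltr_pXn2r// nnegrE ?N_ge0//.
by apply: ltW (le_lt_trans (N_ge0 _) wr).
Qed.

Lemma expR_log_disc_metric rho w : 0 < rho -> N w < rho ->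
  expR (log_disc_metric rho w) = rho ^+ 2 / (rho ^+ 2 - N w ^+ 2) ^+ 2.
Proof.
move=> r0 wr; have w0 := disc_pos wr; rewrite /log_disc_metric expRD lnK ?posrE ?exprn_gt0//.
by rewrite mulNr expRN expRM_natl lnK ?posrE.
Qed.

Lemma subhyp_log_disc_metric rho w : 0 < rho -> N w < rho -> subhyp (log_disc_metric rho) w.
Proof.
move=> rho0 wr f z r r0 hf fz f'0; rewrite -fz in wr *.
have [a [b j]] := jet_ln_disc r0 hf wr.
have j2 := jetD (jet_cst (ln (rho ^+ 2)) z) (jetZ (- 2) j).
do 3 eexists; split; first exact: j2.
by rewrite expR_log_disc_metric// add0r mulrNN; rewrite le_eqVlt; apply/orP; left; apply/eqP; ring.
Qed.

Lemma rtends_log_disc_metric rho w : N w < rho -> rtends (log_disc_metric rho) w (log_disc_metric rho w).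
Proof.
move=> wr; apply: rtendsD; first exact: rtends_cst.
apply: rtendsM; first exact: rtends_cst.
apply: (rtends_comp (phi := @ln R)); last exact/continuous_ln/disc_pos.
apply: (rtends_comp (phi := fun x => rho ^+ 2 - x) (u := fun w => N w ^+ 2)).
  by apply: rtends_sqr; exact: rtends_normc.
apply: contR_eps => e e0; exists e => // x h.
by have -> : rho ^+ 2 - x - (rho ^+ 2 - N w ^+ 2) = - (x - N w ^+ 2) by [ring]; rewrite normrN.
Qed.

Lemma schwarz_pick f r z : 0 < r -> holo f 0 r -> (forall w, N w < r -> N (f w) < 1) ->
  N z < r -> f z = 0 -> N (cderiv f z) ^+ 2 * (r ^+ 2 - N z ^+ 2) ^+ 2 <= r ^+ 2.
Proof.
move=> r0 hf f1 zr fz0.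
have := @ahlfors R f r setT (log_disc_metric 1) r0 hf closedT _ _ z zr I.
rewrite fz0 expR_log_disc_metric ?Normc.normc0// expr0n subr0 expr1n expr1n divr1 mulr1.
apply.
- by move=> w wr _; apply: rtends_log_disc_metric; exact: f1.
- move=> w wr _; right; split; first exact: filterT.
  by apply: subhyp_log_disc_metric => //; exact: f1.
Qed.

(* exp (log_pole x) = (1 + s) / s ^ 4 where s ^ 5 = exp x. Following Minda and
   Schober, the product of two such factors, one for each of two omitted points,
   is the square of a density with negative curvature. *)
Definition log_pole x : R := ln (1 + expR (x / 5)) + - (4 / 5) * x.

Lemma expR_log_pole x : expR (log_pole x) = (1 + expR (x / 5)) / expR (x / 5) ^+ 4.
Proof.
have p1 : 0 < 1 + expR (x / 5) by rewrite addr_gt0// expR_gt0.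
rewrite /log_pole expRD lnK ?posrE//; congr (_ * _).
by rewrite -expRM_natl -expRN; congr expR; field.
Qed.

Lemma is_derive_expR_fifth t : is_derive t 1 (fun x => expR (x / 5)) (expR (t / 5) / 5).
Proof. by apply: is_derive_eq; rewrite /GRing.scale /=; field. Qed.

Definition log_pole' x : R := expR (x / 5) / 5 / (1 + expR (x / 5)) + - (4 / 5).

Lemma is_derive_log_pole s : is_derive s 1 log_pole (log_pole' s).
Proof.
have ps : 0 < 1 + expR (s / 5) :> R by rewrite addr_gt0// expR_gt0.
have dE := is_derive_expR_fifth s; have d1 : is_derive s 1 (fun x => 1 + expR (x / 5)) (expR (s / 5) / 5).
  by apply: is_derive_eq; rewrite /GRing.scale /=; field.
have d2 := is_derive1_ln ps.
have d3 : is_derive s 1 (fun x => ln (1 + expR (x / 5))) (expR (s / 5) / 5 / (1 + expR (s / 5))).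
  by apply: is_derive_eq; rewrite /GRing.scale /= mulrC.
have d4 : is_derive s 1 (fun x : R => - (4 / 5) * x) (- (4 / 5)).
  by apply: is_derive_eq; rewrite /GRing.scale /=; ring.
exact: (is_deriveD d3 d4).
Qed.

Lemma taylor2_log_pole t : exists p, taylor2 log_pole t p
   (expR (t / 5) / (1 + expR (t / 5)) ^+ 2 / 25 / 2).
Proof.
have pos x : 0 < 1 + expR (x / 5) :> R by rewrite addr_gt0// expR_gt0.
exists (log_pole' t); apply: (taylor2P ltr01); first by move=> s _; exact: is_derive_log_pole.
have d1 : is_derive t 1 (fun x => 1 + expR (x / 5)) (expR (t / 5) / 5).
  have dE := is_derive_expR_fifth t.
  by apply: is_derive_eq; rewrite /GRing.scale /=; field.
have d2 := is_deriveV (f := fun x => 1 + expR (x / 5)) (lt0r_neq0 (pos t)) d1.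
(* In the form c + k / (1 + exp (x / 5)), [log_pole'] requires only the derivative of a
   reciprocal. *)
pose c : R := 1 / 5 - 4 / 5; pose k : R := - (1 / 5).
have d3 := is_deriveD (is_derive_cst c t 1) (is_deriveZ k d2).
have -> : log_pole' = cst c + k *: (fun x => (1 + expR (x / 5))^-1).
  apply/funext => x; rewrite /log_pole' /c /k.
  rewrite -[RHS]/(1 / 5 - 4 / 5 + - (1 / 5) * (1 + expR (x / 5))^-1).
  by field; rewrite gt_eqF.
apply: is_derive_eq d3 _; rewrite /k /GRing.scale /=.
by field; rewrite gt_eqF.
Qed.

(** The arguments of [log_pole] are the logarithms of |w - a| ^ 2 / e ^ 2 and |w - b| ^ 2 / e ^ 2,
    so the metric lives at scale e. In 50 * 100, a factor 25 stems from the fifth roots, 2 from the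
    curvature condition in [subhyp], and 100 from [pair_curvature]. *)
Definition log_pair_metric a b e w : R := ln ((50 * 100 * e ^+ 2)^-1) +
  (log_pole (ln (N (w - a) ^+ 2) - ln (e ^+ 2)) + log_pole (ln (N (w - b) ^+ 2) - ln (e ^+ 2))).

Lemma fifth_root_ratio x e : 0 < x -> 0 < e ->
  expR ((ln (x ^+ 2) - ln (e ^+ 2)) / 5) ^+ 5 = x ^+ 2 / e ^+ 2.
Proof.
move=> x0 e0; rewrite -expRM_natl mulrC divfK; last by rewrite pnatr_eq0.
by rewrite expRB !lnK ?posrE ?exprn_gt0.
Qed.

(** As ln |f - a| ^ 2 is harmonic, only the second derivative of [log_pole] counts; |f - a| ^ 2 = p
    ^ 5 e ^ 2 then eliminates f - a. *)
Lemma jet_log_pole f a z r e : 0 < r -> holo f z r -> 0 < e -> f z != a ->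
  let p := expR ((ln (N (f z - a) ^+ 2) - ln (e ^+ 2)) / 5) in
  exists k l, jet (fun w => log_pole (ln (N (f w - a) ^+ 2) - ln (e ^+ 2))) z k l
    (N (cderiv f z) ^+ 2 / e ^+ 2 / 25 / ((1 + p) ^+ 2 * p ^+ 4)).
Proof.
move=> r0 hf e0 fza p.
have hfa : holo (fun w => f w - a) z r.
  by move=> w /hf[l fl]; exists (l - 0); exact: (cderB fl (cder_cst a w)).
have zr : N (z - z) < r by rewrite subrr Normc.normc0.
have dfa : cderiv (fun w => f w - a) z = cderiv f z.
  by rewrite -[RHS]subr0; apply: cderivE; exact: (cderB (cderivP (hf z zr)) (cder_cst a z)).
have fza0 : f z - a != 0 by rewrite subr_eq0.
have [k [l [j kE]]] := jet_ln_normsq r0 hfa fza0.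
have {}j := jetD j (jet_cst (- ln (e ^+ 2)) z).
have [q tq] := taylor2_log_pole (ln (N (f z - a) ^+ 2) - ln (e ^+ 2)).
have {}j := jet_comp j tq.
do 2 eexists; move: j; congr (jet _ _ _ _ _).
rewrite !addr0 mulr0 add0r kE dfa -/p.
have x0 : 0 < N (f z - a) by rewrite N_gt0.
have p0 : 0 < p by exact: expR_gt0.
have pE : N (f z - a) ^+ 2 = p ^+ 5 * e ^+ 2.
  by rewrite (fifth_root_ratio x0 e0) divfK// gt_eqF// exprn_gt0.
by rewrite pE; field; rewrite !gt_eqF// addr_gt0.
Qed.

Lemma expR_log_pair_metric a b e w : 0 < e ->
  let p := expR ((ln (N (w - a) ^+ 2) - ln (e ^+ 2)) / 5) in
  let q := expR ((ln (N (w - b) ^+ 2) - ln (e ^+ 2)) / 5) in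
  expR (log_pair_metric a b e w) = (1 + p) / p ^+ 4 * ((1 + q) / q ^+ 4) / (50 * 100 * e ^+ 2).
Proof.
move=> e0 p q; rewrite /log_pair_metric expRD [expR (log_pole _ + log_pole _)]expRD !expR_log_pole lnK 1?mulrC//.
by rewrite posrE invr_gt0 mulr_gt0// exprn_gt0.
Qed.

(** Since p <= q and 1 <= 2 q, both 1 + p and 1 + q are at most 3 q, and 3 ^ 4 <= 100. *)
Lemma pair_curvature p q : 0 < p -> 2^-1 <= q -> p <= q ->
  (1 + p) * (1 + q) <= 100 * (p ^+ 4 / (1 + q) ^+ 2 + q ^+ 4 / (1 + p) ^+ 2).
Proof.
move=> p0 q2 pq.
have q0 : 0 < q by lra.
have h1 : (1 + p) ^+ 3 * (1 + q) <= (3 * q) ^+ 4.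
  rewrite [leRHS]exprSr; apply: ler_pM; rewrite ?exprn_ge0//; try lra.
  by rewrite ler_pXn2r// ?nnegrE; lra.
have h2 : (1 + p) * (1 + q) <= 100 * (q ^+ 4 / (1 + p) ^+ 2).
  rewrite mulrA ler_pdivlMr ?exprn_gt0//; last lra.
  have -> : (1 + p) * (1 + q) * (1 + p) ^+ 2 = (1 + p) ^+ 3 * (1 + q) by ring.
  apply: le_trans h1 _; rewrite exprMn ler_wpM2r ?exprn_ge0//; first lra.
  by rewrite -natrX ler_nat.
apply: le_trans h2 _; rewrite ler_wpM2l// lerDr divr_ge0// exprn_ge0//; lra.
Qed.

Lemma subhyp_log_pair_metric a b e w : 0 < e -> e <= N (a - b) -> w != a -> w != b ->
  subhyp (log_pair_metric a b e) w.
Proof.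
move=> e0 abe wa wb f z r r0 hf fz f'0; rewrite -fz in wa wb *.
have [k [l j1]] := jet_log_pole r0 hf e0 wa; have [k' [l' j2]] := jet_log_pole r0 hf e0 wb.
have j := jetD (jet_cst (ln ((50 * 100 * e ^+ 2)^-1)) z) (jetD j1 j2).
do 3 eexists; split; first exact: j.
rewrite expR_log_pair_metric//.
have a0 : 0 < N (f z - a) by rewrite N_gt0 subr_eq0.
have b0 : 0 < N (f z - b) by rewrite N_gt0 subr_eq0.
have pE := fifth_root_ratio a0 e0; have qE := fifth_root_ratio b0 e0.
have := expR_gt0 ((ln (N (f z - b) ^+ 2) - ln (e ^+ 2)) / 5).
have := expR_gt0 ((ln (N (f z - a) ^+ 2) - ln (e ^+ 2)) / 5).
move: pE qE; set p := expR _; set q := expR _ => pE qE p0 q0.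
(* It will be applied to the farther of a and b, at distance at least e / 2: there s ^ 5 >= 1 / 4 >
   (1 / 2) ^ 5. *)
have half x s : 0 < s -> s ^+ 5 = x ^+ 2 / e ^+ 2 -> e / 2 <= x -> 2^-1 <= s.
  move=> s0 sE ex; rewrite leNgt; apply/negP => s2.
  have h1 : s ^+ 5 < 2^-1 ^+ 5 by rewrite ltr_pXn2r// ?nnegrE//; lra.
  have h2 : 2^-1 ^+ 2 <= s ^+ 5.
    rewrite sE ler_pdivlMr ?exprn_gt0// -exprMn ler_pXn2r// ?nnegrE; lra.
  have h3 : (2^-1 : R) ^+ 5 <= 2^-1 ^+ 2 by apply: ler_wiXn2l; lra.
  by have := lt_le_trans h1 (le_trans h3 h2); rewrite ltxx.
have key : (1 + p) * (1 + q) <= 100 * (p ^+ 4 / (1 + q) ^+ 2 + q ^+ 4 / (1 + p) ^+ 2).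
  have ab : e <= N (f z - a) + N (f z - b).
    by have := N_tri a (f z) b; rewrite (N_distC a (f z)); lra.
  have mono x y s t : 0 < x -> 0 < y -> 0 < s -> 0 < t -> s ^+ 5 = x ^+ 2 / e ^+ 2 ->
      t ^+ 5 = y ^+ 2 / e ^+ 2 -> x <= y -> s <= t.
    move=> x0 y0 s0 t0 sE tE xy; rewrite -(ler_pXn2r (n := 5)) ?nnegrE ?(ltW s0) ?(ltW t0)//.
    by rewrite sE tE ler_pM2r ?invr_gt0 ?exprn_gt0// ler_pXn2r// nnegrE ltW.
  have [le|/ltW le] := leP (N (f z - a)) (N (f z - b)).
    apply: pair_curvature => //; last exact: mono pE qE le.
    by apply: half qE _ => //; lra.
  rewrite mulrC [X in 100 * X]addrC; apply: pair_curvature => //; last exact: mono qE pE le.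
  by apply: half pE _ => //; lra.
have F0 := sqr_ge0 (N (cderiv f z)).
have -> : 0 + (N (cderiv f z) ^+ 2 / e ^+ 2 / 25 / ((1 + p) ^+ 2 * p ^+ 4) +
    N (cderiv f z) ^+ 2 / e ^+ 2 / 25 / ((1 + q) ^+ 2 * q ^+ 4)) =
  N (cderiv f z) ^+ 2 / e ^+ 2 / (50 * 50) / (p ^+ 4 * q ^+ 4) *
    (100 * (p ^+ 4 / (1 + q) ^+ 2 + q ^+ 4 / (1 + p) ^+ 2)).
  by field; rewrite !gt_eqF// addr_gt0.
have -> : 2 * N (cderiv f z) ^+ 2 * ((1 + p) / p ^+ 4 * ((1 + q) / q ^+ 4) / (50 * 100 * e ^+ 2)) =
  N (cderiv f z) ^+ 2 / e ^+ 2 / (50 * 50) / (p ^+ 4 * q ^+ 4) * ((1 + p) * (1 + q)).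
  by field; rewrite !gt_eqF.
have c0 : 0 <= 50 * 50 :> R by lra.
apply: ler_wpM2l key; apply: divr_ge0.
  by apply: divr_ge0 c0; exact: divr_ge0 F0 (sqr_ge0 e).
by apply: mulr_ge0; apply: exprn_ge0; exact: ltW.
Qed.

Lemma rtends_log_pair_metric a b e w : w != a -> w != b ->
  rtends (log_pair_metric a b e) w (log_pair_metric a b e w).
Proof.
have part (c : C) : w != c ->
    rtends (fun w => log_pole (ln (N (w - c) ^+ 2) - ln (e ^+ 2))) w
      (log_pole (ln (N (w - c) ^+ 2) - ln (e ^+ 2))).
  move=> wc; apply: (rtends_comp (phi := log_pole)); last first.
    apply/differentiable_continuous/derivable1_diffP.
    by have [] := is_derive_log_pole (ln (N (w - c) ^+ 2) - ln (e ^+ 2)).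
  apply: rtendsD; last exact: rtends_cst.
  apply: (rtends_comp (phi := @ln R)); last by apply: continuous_ln; rewrite exprn_gt0// N_gt0 subr_eq0.
  by apply: rtends_sqr; apply: rtends_N; exact: (ctendsB (ctends_id w) (ctends_cst c w)).
move=> wa wb; apply: rtendsD; first exact: rtends_cst.
by apply: rtendsD; exact: part.
Qed.

Lemma landau f a b e z : holo f 0 1 -> (forall w, N w < 1 -> f w != a /\ f w != b) ->
  0 < e -> e <= N (a - b) -> N z < 1 -> N (f z - a) <= 7 * e -> N (f z - b) <= 7 * e ->
  N (cderiv f z) * (1 - N z ^+ 2) <= 60 * 100 * e.
Proof.
move=> hf fab e0 abe z1 za zb.
have := @ahlfors R f 1 setT (log_pair_metric a b e) ltr01 hf closedT _ _ z z1 I.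
rewrite expr1n => H.
have {}H : N (cderiv f z) ^+ 2 * (1 - N z ^+ 2) ^+ 2 * expR (log_pair_metric a b e (f z)) <= 1.
  apply: H => w wr _; have [wa wb] := fab w wr; first exact: rtends_log_pair_metric.
  by right; split; [exact: filterT|exact: subhyp_log_pair_metric].
have [fa fb] := fab z z1.
(* Here p ^ 5 <= 49 <= 3 ^ 5, and (1 + p) / p ^ 4 >= 1 / p ^ 3 >= 1 / 27. *)
have big (c : C) : f z != c -> N (f z - c) <= 7 * e ->
    27^-1 <= (1 + expR ((ln (N (f z - c) ^+ 2) - ln (e ^+ 2)) / 5)) /
       expR ((ln (N (f z - c) ^+ 2) - ln (e ^+ 2)) / 5) ^+ 4.
  move=> fc le; have c0 : 0 < N (f z - c) by rewrite N_gt0 subr_eq0.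
  have := fifth_root_ratio c0 e0.
  have := expR_gt0 ((ln (N (f z - c) ^+ 2) - ln (e ^+ 2)) / 5).
  move: (expR _) => p p0 pE.
  have p3 : p <= 3.
    rewrite -(ler_pXn2r (n := 5)) ?nnegrE ?(ltW p0)//; apply: le_trans (_ : (7 : R) ^+ 2 <= _).
      rewrite pE ler_pdivrMr ?exprn_gt0// -exprMn ler_pXn2r// ?nnegrE//; lra.
    by rewrite -!natrX ler_nat.
  rewrite ler_pdivlMr ?exprn_gt0// mulrC ler_pdivrMr//.
  have -> : p ^+ 4 = p ^+ 3 * p by ring.
  have p27 : p ^+ 3 <= 27.
    apply: le_trans (_ : (3 : R) ^+ 3 <= _); first by rewrite ler_pXn2r// nnegrE ltW.
    by rewrite -natrX ler_nat.
  by have := ler_wpM2r (ltW p0) p27; lra.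
have Ppos : 0 < 50 * 100 * e ^+ 2 by rewrite mulr_gt0// exprn_gt0.
(* This is 27 ^ 2 * 5000 <= 6000 ^ 2, with room to spare. *)
have vbig : ((60 * 100 * e) ^+ 2)^-1 <= expR (log_pair_metric a b e (f z)).
  rewrite expR_log_pair_metric// ler_pdivlMr//.
  apply: le_trans (_ : 27^-1 * 27^-1 <= _).
    have -> : ((60 * 100 * e) ^+ 2)^-1 * (50 * 100 * e ^+ 2) = (72 * 100)^-1 by field; rewrite gt_eqF.
    by rewrite -invfM lef_pV2 ?posrE//; lra.
  by apply: ler_pM; rewrite ?invr_ge0//; exact: big.
have z1' : 0 <= 1 - N z ^+ 2 by rewrite subr_ge0 expr_le1 ?N_ge0// ltW.
have k0 : 0 < 60 * 100 * e by lra.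
have A0 : 0 <= N (cderiv f z) * (1 - N z ^+ 2) by apply: mulr_ge0 => //; exact: N_ge0.
rewrite -(ler_pXn2r (n := 2)) ?nnegrE ?A0 ?(ltW k0)//.
have sq0 : 0 <= N (cderiv f z) ^+ 2 * (1 - N z ^+ 2) ^+ 2 by rewrite mulr_ge0 ?sqr_ge0.
have := le_trans (ler_wpM2l sq0 vbig) H.
by rewrite ler_pdivrMr ?exprn_gt0// mul1r -exprMn.
Qed.

(* By landau, f satisfies the Schwarz-Pick inequality for the disc of radius
   1 + 6000 e at points mapped to the unit circle; Ahlfors' argument inside the
   unit disc does the rest. *)
Lemma density_lower_bound f e : holo f 0 1 -> 0 < e -> N (f 0) < 1 ->
  (forall w, N w = 1 -> exists a b, [/\ forall z, N z < 1 -> f z != a /\ f z != b,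
     e <= N (a - b), N (w - a) <= 7 * e & N (w - b) <= 7 * e]) ->
  N (cderiv f 0) ^+ 2 * ((1 + 60 * 100 * e) ^+ 2 / ((1 + 60 * 100 * e) ^+ 2 - N (f 0) ^+ 2) ^+ 2) <= 1.
Proof.
move=> hf e0 f0 H; set rho := 1 + 60 * 100 * e.
have rho1 : 1 < rho by rewrite /rho; lra.
have rho0 : 0 < rho by lra.
have z0 : N (0 : C) < 1 by rewrite Normc.normc0.
have cF : closed (@cdisc R 0 1).
  apply: closedCP => z zF; apply/ler_addgt0Pr => x /zF[w w1 wx].
  by have := N_tri z w 0; rewrite (N_distC z w); rewrite /cdisc /= in w1; lra.
have := @ahlfors R f 1 (@cdisc R 0 1) (log_disc_metric rho) ltr01 hf cF _ _ 0 z0.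
rewrite expr1n Normc.normc0 expr0n subr0 expr1n mulr1 expR_log_disc_metric//; last lra.
apply; last by rewrite /cdisc /= subr0 ltW.
  by move=> z _; rewrite /cdisc /= subr0 => fz; apply: rtends_log_disc_metric; lra.
move=> z z1; rewrite /cdisc /= subr0 le_eqVlt => /orP[/eqP fz|fz]; last first.
  right; split; last by apply: subhyp_log_disc_metric => //; lra.
  apply/nbhsCP; exists (1 - N (f z)); first by rewrite subr_gt0.
  by move=> w wf; have := N_tri w (f z) 0; rewrite /cdisc /= !subr0; lra.
(* At points mapped to the unit circle [landau] supplies the boundary condition, because 6000 e =
   rho - 1 and (rho - 1) rho <= rho ^ 2 - 1. *)
left; have [a [b [fab abe fa fb]]] := H (f z) fz.
have la := landau hf fab e0 abe z1 fa fb.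
have z1' : 0 <= 1 - N z ^+ 2 by rewrite subr_ge0 expr_le1 ?N_ge0// ltW.
rewrite expR_log_disc_metric ?fz// expr1n -exprMn.
have d0 : 0 < rho ^+ 2 - 1 by rewrite subr_gt0 expr_gt1// ltW.
have -> : (rho ^+ 2 / (rho ^+ 2 - 1) ^+ 2) = (rho / (rho ^+ 2 - 1)) ^+ 2 by rewrite expr_div_n.
rewrite -exprMn expr_le1//; last first.
  by rewrite !mulr_ge0 ?N_ge0 ?invr_ge0 ?(ltW d0) ?(ltW rho0).
rewrite mulrA ler_pdivrMr// mul1r; apply: le_trans (ler_wpM2r (ltW rho0) la) _.
rewrite /rho; nra.
Qed.

End Metrics.

(** * Local sections of holomorphic maps *)


Section Sections.
Context {R : realType}.
Local Notation C := R[i].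
Local Notation N := (@Normc.normc R).
Implicit Types (z w l k a b c : C) (f g h p : C -> C) (x y s t e d r rho : R).

Lemma geometric_small x e : 0 <= x < 1 -> 0 < e -> exists n, x ^+ n < e.
Proof.
move=> /andP[x0 x1] e0.
have xn : `|x| < 1 by rewrite ger0_norm.
have /cvgrPdist_lt/(_ e e0)[n _ H] := cvg_expr xn.
exists n; have := H n (leqnn n); rewrite /= sub0r normrN ger0_norm// exprn_ge0//.
Qed.

(** If f is divisible by (w - c) ^ n for every n, the maximum modulus principle for the quotients
    gives |f z| <= M (|z - c| / rho) ^ n, which tends to 0. *)
Lemma zero_order f c r : 0 < r -> holo f c r ->
  (forall z, N (z - c) < r / 2 -> f z = 0) \/
  exists n h, [/\ holo h c r, h c != 0 & forall w, f w = (w - c) ^+ n * h w].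
Proof.
move=> r0 hf.
have [[n [h [hh hc fE]]]|none] := pselect (exists n h,
    [/\ holo h c r, h c != 0 & forall w, f w = (w - c) ^+ n * h w]).
  by right; exists n, h.
left; have fact n : exists2 h, holo h c r & forall w, f w = (w - c) ^+ n * h w.
  elim: n => [|n [h hh fE]]; first by exists f => // w; rewrite expr0 mul1r.
  have [hc0|hc0] := eqVneq (h c) 0; last by exfalso; apply: none; exists n, h.
  have [Q hQ hE] := holo_quot r0 hh.
  exists Q => // w; rewrite fE exprSr -mulrA; congr (_ * _).
  by rewrite -[LHS]subr0 -hc0 hE mulrC.
pose rho := r / 2; have rho0 : 0 < rho by rewrite divr_gt0.
have rhor : rho < r by rewrite /rho; lra.
have cf g z : holo g c r -> N (z - c) <= rho -> ctends g z (g z).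
  by move=> hg zr; apply: holo_cont hg _; lra.
have [M M0 fM] := bounded_on_cdisc (ltW rho0) (fun z => @cf f z hf).
move=> z zr; apply/eqP; rewrite -N_eq0 eq_le N_ge0 andbT.
apply/ler_addgt0Pr => e e0; rewrite add0r.
have q1 : 0 <= N (z - c) / rho < 1.
  by rewrite divr_ge0 ?N_ge0 ?(ltW rho0)//= ltr_pdivrMr// mul1r.
have [n nP] := geometric_small q1 (divr_gt0 e0 M0).
have [h hh fE] := fact n.
have hM : N (h z) <= M / rho ^+ n.
  apply: (maximum_modulus (c := c) (r := rho) (E := [::]) rho0) => //; last exact: ltW.
  - by move=> w; exact: cf.
  - by move=> w wr _; apply: hh; lra.
  - move=> w wr; have := fM w; rewrite wr lexx fE Normc.normcM N_exp wr => /(_ isT).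
    by rewrite ler_pdivlMr ?exprn_gt0// mulrC.
rewrite fE Normc.normcM N_exp.
apply: le_trans (ler_wpM2l (exprn_ge0 _ (N_ge0 _)) hM) _.
have -> : N (z - c) ^+ n * (M / rho ^+ n) = (N (z - c) / rho) ^+ n * M.
  by rewrite [in RHS]exprMn exprVn mulrCA mulrC.
by rewrite -ler_pdivlMr// ltW.
Qed.

Lemma cder_pow c n z : cder (fun w => (w - c) ^+ n) z (n%:R * (z - c) ^+ n.-1).
Proof.
have d1 : cder (fun w => w - c) z 1 by rewrite -[1]subr0; exact: (cderB (cder_id z) (cder_cst c z)).
elim: n => [|n IH].
  by rewrite mul0r; have -> : (fun w => (w - c) ^+ 0) = fun=> 1 by []; exact: cder_cst.
have -> : (fun w => (w - c) ^+ n.+1) = (fun w => (w - c) ^+ n * (w - c)).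
  by apply/funext => w; rewrite exprSr.
have := cderM IH d1; congr cder; rewrite mulr1 -mulrA.
case: n {IH} => [|n]; first by rewrite mul0r add0r mul1r.
by rewrite /= -exprSr -[in RHS]natr1 mulrDl mul1r.
Qed.

(** If p w - p c = (w - c) ^ (n + 1) h w with h c nonzero, then p' z = (z - c) ^ n q z where q c =
    (n + 1) h c. *)
Lemma isolated_critical p c r : 0 < r -> holo p c r ->
  (forall z, N (z - c) < r / 2 -> p z = p c) \/
  exists2 d, 0 < d & forall z, 0 < N (z - c) < d -> cderiv p z != 0.
Proof.
move=> r0 hp.
have hpc : holo (fun w => p w - p c) c r.
  by move=> z /hp[l pl]; exists (l - 0); exact: (cderB pl (cder_cst (p c) z)).
have [H|[[|n] [h [hh hc pE]]]] := zero_order r0 hpc.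
- by left => z /H/subr0_eq.
- by move: hc; rewrite -[h c]mul1r -(expr0 (c - c)) -pE subrr eqxx.
right; have cr : N (c - c) < r by rewrite subrr Normc.normc0.
pose q w := n.+1%:R * h w + (w - c) * cderiv h w.
have cq : ctends q c (q c).
  apply: ctendsD; first exact: (ctendsM (ctends_cst _ c) (holo_cont hh cr)).
  exact: (ctendsM (ctendsB (ctends_id c) (ctends_cst c c)) (holo_cont (holo_cderiv hh) cr)).
have qc0 : 0 < N (q c).
  by rewrite N_gt0 /q subrr mul0r addr0 mulf_neq0// pnatr_eq0.
have [d d0 dP] := (ctendsP _ _ _).1 cq _ qc0.
exists (Num.min d r) => [|z]; first by rewrite lt_min d0.
rewrite lt_min => /and3P[z0 zd zr].
have zc : z - c != 0 by rewrite -N_gt0.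
have -> : cderiv p z = (z - c) ^+ n * q z.
  have pE' w : p w = p c + (w - c) ^+ n.+1 * h w by rewrite -pE subrKC.
  apply: cderivE; have -> : p = (fun w => p c + (w - c) ^+ n.+1 * h w) by apply/funext.
  have := cderD (cder_cst (p c) z) (cderM (cder_pow c n.+1 z) (cderivP (hh z zr))).
  by congr cder; rewrite add0r /q exprS /=; ring.
rewrite mulf_neq0// ?expf_neq0//.
by apply: contraTneq (dP z zd) => ->; rewrite sub0r normcN ltxx.
Qed.

Lemma cder_section p f w0 l d : 0 < d -> (forall w, N (w - w0) < d -> p (f w) = w) ->
  ctends f w0 (f w0) -> cder p (f w0) l -> l != 0 -> cder f w0 l^-1.
Proof.
move=> d0 pf cf [Q [pQ Ql Qc]] l0.
exists (fun w => if w == w0 then l^-1 else (f w - f w0) / (w - w0)); split.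
- move=> w; case: eqVneq => [->|wz]; first by rewrite !subrr mulr0.
  by rewrite divfK // subr_eq0.
- by rewrite eqxx.
have cQf : ctends (fun w => (Q (f w))^-1) w0 l^-1 by apply: ctendsV l0 _; exact: (ctends_comp cf Qc).
apply: ctends_near cQf; exists d => // w wd.
case: eqVneq => [->|wz]; first by rewrite Ql.
have w0' : p (f w0) = w0 by apply: pf; rewrite subrr Normc.normc0.
have e : w - w0 = Q (f w) * (f w - f w0) by rewrite -pQ pf// w0'.
have : Q (f w) * (f w - f w0) != 0 by rewrite -e subr_eq0.
rewrite mulf_eq0 negb_or => /andP[q0 fw0].
by rewrite e invfM mulrCA mulfV// mulr1.
Qed.

(* If p' vanished at f w0 the section f would still be differentiable off w0,
   hence at w0 by removability, contradicting the chain rule. *)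
Lemma section_neq0 p f w0 r d : 0 < r -> holo p (f w0) r -> 0 < d ->
  (forall w, N (w - w0) < d -> p (f w) = w) ->
  (forall w, N (w - w0) < d -> ctends f w (f w)) -> cderiv p (f w0) != 0.
Proof.
move=> r0 hp d0 pf cf.
have w0d : N (w0 - w0) < d by rewrite subrr Normc.normc0.
have pw0 := pf w0 w0d.
have cf0 := (ctendsP _ _ _).1 (cf w0 w0d).
have [pcst|[e e0 pne]] := isolated_critical r0 hp.
  have r20 : 0 < r / 2 by rewrite divr_gt0.
  have [d' d'0 d'P] := cf0 _ r20.
  pose x := Num.min d d' / 2.
  have m0 : 0 < Num.min d d' by rewrite lt_min d0.
  have x0 : 0 < x by rewrite divr_gt0.
  have : x < Num.min d d' by rewrite /x; lra.
  rewrite lt_min => /andP[xd xd'].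
  have e : w0 + x%:C - w0 = x%:C by ring.
  have Nx : N (w0 + x%:C - w0) = x by rewrite e N_real gtr0_norm.
  have := pcst (f (w0 + x%:C)); rewrite pf ?Nx// pw0 => H.
  have := H (d'P _ _); rewrite Nx => /(_ xd') E.
  by move: Nx; rewrite E subrr Normc.normc0 => E'; rewrite -E' ltxx in x0.
pose er := Num.min e r; have er0 : 0 < er by rewrite lt_min e0.
have [d' d'0 d'P] := cf0 _ er0.
have [|||l fl] := @removable_singularity R f w0 (Num.min d d').
- by rewrite lt_min d0.
- exact: cf.
- move=> w /andP[ww]; rewrite lt_min => /andP[wd wd'].
  have := d'P w wd'; rewrite lt_min => /andP[fe fr].
  have fw0 : 0 < N (f w - f w0).
    rewrite N_gt0 subr_eq0; apply: contraTneq ww => E.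
    by rewrite -(pf w wd) E pw0 subrr Normc.normc0 ltxx.
  have s0 : 0 < d - N (w - w0) by rewrite subr_gt0.
  have dw : forall w', N (w' - w) < d - N (w - w0) -> p (f w') = w'.
    by move=> w' h; apply: pf; have := N_tri w' w w0; lra.
  exists (cderiv p (f w))^-1; apply: cder_section s0 dw (cf w wd) (cderivP (hp _ fr)) _.
  by apply: pne; rewrite fw0.
have fr0 : N (f w0 - f w0) < r by rewrite subrr Normc.normc0.
have := cder_comp fl (cderivP (hp _ fr0)).
have idn : cder (fun w => p (f w)) w0 1.
  by apply: cder_near (cder_id w0); exists d => // w /pf.
move=> /cder_unique/(_ idn) E.
by apply/eqP => E0; move/eqP: E; rewrite E0 mul0r eq_sym oner_eq0.
Qed.

End Sections.

(** * Lifting discs through coverings *)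


Section Lifting.
Context {R : realType}.
Local Notation C := R[i].
Local Notation N := (@Normc.normc R).
Implicit Types (z w l k a b c y : C) (f g h p : C -> C) (x s t e d r rho : R).

(** The section passes through a given preimage of any point of the disc, not only of y. The
    property therefore passes to nearby centres, which yields a uniform d on compact sets. *)
Definition sections_near p y d := forall z, N z < 1 -> N (p z - y) < d ->
  exists f, f (p z) = z /\
    forall w, N (w - y) < d -> [/\ p (f w) = w, N (f w) < 1 & ctends f w (f w)].

Definition locally_injective p := forall z, N z < 1 ->
  exists2 d, 0 < d & forall w w', N (w - z) < d -> N (w' - z) < d -> p w = p w' -> w = w'.

Lemma unit_discE z : unit_disc z <-> N z < 1.
Proof. by rewrite /unit_disc /= normCE -[1]/((1 : R)%:C) ltcR. Qed.

Lemma covering_sheet p (W : set C) z : covering_map unit_disc W p -> N z < 1 ->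
  exists U V : set C, [/\ open U, U (p z), open V, V z &
    [/\ V `<=` unit_disc, homeo_on p V U & U `<=` W]].
Proof.
move=> [_ pW ev] z1; have Wpz : W (p z) by rewrite -pW; exists z => //; apply/unit_discE.
have [U [oU Upz UW [S [ES _ SP]]]] := ev _ Wpz.
have [V SV Vz] : (\bigcup_(V in S) V) z by rewrite -ES; split => //; apply/unit_discE.
have [oV hV] := SP V SV; exists U, V; split => //; split => // x Vx.
by have [] : (unit_disc `&` p @^-1` U) x by rewrite ES; exists V.
Qed.

Lemma covering_locally_injective p (W : set C) :
  covering_map unit_disc W p -> locally_injective p.
Proof.
move=> cov z z1; have [U [V [_ _ oV Vz [_ [[_ inj _] _ _] _]]]] := covering_sheet cov z1.
have [d d0 dV] := (nbhsCP _ _).1 (open_nbhs_nbhs (conj oV Vz)).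
by exists d => // w w' /dV Vw /dV Vw' pE; apply: inj; rewrite ?inE.
Qed.

Lemma covering_sections p (W : set C) y :
  covering_map unit_disc W p -> W y -> exists2 d, 0 < d & sections_near p y d.
Proof.
move=> [_ _ ev] Wy; have [U [oU Uy UW [S [ES _ SP]]]] := ev _ Wy.
have [d d0 dU] := (nbhsCP _ _).1 (open_nbhs_nbhs (conj oU Uy)).
exists d => // z z1 /dU Upz.
have [V SV Vz] : (\bigcup_(V in S) V) z by rewrite -ES; split => //; apply/unit_discE.
have [oV [[_ _ surj] _ [s cs sp]]] := SP V SV.
exists s; split; first exact: sp.
move=> w /dU Uw; have [x Vx pxw] := surj w Uw.
have sw : s w = x by rewrite -pxw sp.
split; first by rewrite sw.
- apply/unit_discE; rewrite sw.
  by have [] : (unit_disc `&` p @^-1` U) x by rewrite ES; exists V.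
- constructor; move: cs; rewrite continuous_open_subspace// => cs.
  by apply: cs; rewrite inE.
Qed.

Lemma sections_near_sub p y y' d : sections_near p y d -> N (y' - y) <= d / 2 ->
  forall d', d' <= d / 2 -> sections_near p y' d'.
Proof.
move=> sy yy d' dd z z1 zy; have [|f [fz fP]] := sy z z1.
  by have := N_tri (p z) y' y; lra.
by exists f; split => // w wy; apply: fP; have := N_tri w y' y; lra.
Qed.

Lemma sections_uniform p (A : set C) : compact A ->
  (forall y, A y -> exists2 d, 0 < d & sections_near p y d) ->
  exists2 d, 0 < d & forall y, A y -> sections_near p y d.
Proof.
move=> /compact_near_coveringP cA H.
have := cA R 0^'+ (fun d y => sections_near p y d) _.
case.
  move=> y /H[d d0 sy]; exists ([set y' | N (y' - y) < d / 2], [set x | x < d / 2]).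
    split; first by apply/nbhsCP; exists (d / 2) => //; rewrite divr_gt0.
    by apply: nbhs_right_lt; rewrite divr_gt0.
  by move=> [y' x] /= [yy xd]; apply: sections_near_sub sy (ltW yy) _ (ltW xd).
move=> d /= d0 dP; exists (d / 2); first by rewrite divr_gt0.
apply: dP; last by rewrite /= divr_gt0.
by rewrite /= sub0r normrN gtr0_norm ?divr_gt0//; lra.
Qed.

(** Connectedness of the unit interval. It serves the uniqueness of lifts and, later, the inclusion
    of a disc in W. *)
Lemma locally_constant01 (P : R -> Prop) : P 0 ->
  (forall t, 0 <= t <= 1 -> exists2 d, 0 < d & forall t', 0 <= t' <= 1 -> `|t' - t| < d ->
     (P t' <-> P t)) -> P 1.
Proof.
move=> P0 loc; pose S := [set t | 0 <= t <= 1 /\ forall s, 0 <= s <= t -> P s].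
have S0 : S 0.
  by split=> [|s s0]; [rewrite lexx ler01|have -> : s = 0 by lra].
have ubS : ubound S 1 by move=> t [/andP[]].
have hS : has_sup S by split; [exists 0|exists 1].
have c0 : 0 <= sup S by apply: ub_le_sup => //; exists 1.
have c1 : sup S <= 1 by apply: ge_sup => //; exists 0.
have [|d d0 dP] := loc (sup S); first by rewrite c0 c1.
have [t [/andP[t0 t1] tP] tc] := sup_adherent d0 hS.
have tle : t <= sup S by apply: ub_le_sup; [exists 1|split => //; rewrite t0].
have Pc : P (sup S).
  apply/(dP t); [by rewrite t0| by rewrite ler0_norm; lra|apply: tP].
  by rewrite t0 lexx.
have up s : 0 <= s <= 1 -> s < sup S + d -> P s.
  move=> s01 sd; have [st|ts] := leP s t; first by apply: tP; case/andP: s01 => ->.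
  by apply/(dP s) => //; rewrite ltr_norml; lra.
have [c1'|c1'] := leP 1 (sup S + d / 2); first by apply: up; lra.
have : sup S + d / 2 <= sup S.
  apply: ub_le_sup; first by exists 1.
  by split=> [|s /andP[s0 sd]]; [lra|apply: up; lra].
by lra.
Qed.

(** Along the segment, agreement is an open condition by local injectivity and disagreement is one
    by continuity. *)
Lemma section_unique p (A : set C) f g a b : locally_injective p ->
  (forall t, 0 <= t <= 1 -> A (a + t%:C * (b - a))) ->
  (forall w, A w -> [/\ p (f w) = w, N (f w) < 1 & ctends f w (f w)]) ->
  (forall w, A w -> [/\ p (g w) = w, N (g w) < 1 & ctends g w (g w)]) ->
  f a = g a -> f b = g b.
Proof.
move=> inj Aseg fP gP fga; pose c t := a + t%:C * (b - a).
have c1 : c 1 = b by rewrite /c rmorph1 mul1r subrKC.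
have -> : b = c 1 by [].
pose P t := f (c t) = g (c t).
suff : P 1 by [].
apply: locally_constant01; first by rewrite /P /c rmorph0 mul0r addr0.
move=> t t01; have Ac := Aseg t t01.
have [pf f1 /ctendsP cf] := fP _ Ac; have [pg g1 /ctendsP cg] := gP _ Ac.
have cc e : 0 < e -> exists2 d, 0 < d & forall t', `|t' - t| < d -> N (c t' - c t) < e.
  move=> e0; exists (e / (N (b - a) + 1)) => [|t' tt]; first by rewrite divr_gt0 ?ltr_wpDl ?N_ge0.
  have -> : c t' - c t = (t' - t)%:C * (b - a) by rewrite /c rmorphB /=; ring.
  rewrite Normc.normcM N_real; move: tt; rewrite ltr_pdivlMr ?ltr_wpDl ?N_ge0//.
  by have := normr_ge0 (t' - t); lra.
have [E|E] := pselect (P t).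
  have [d d0 dP] := inj _ f1.
  have [d1 d10 d1P] := cf _ d0; have [d2 d20 d2P] := cg _ d0.
  have [|e e0 eP] := cc (Num.min d1 d2); first by rewrite lt_min d10.
  exists e => // t' t'01 /eP; rewrite lt_min => /andP[/d1P h1 /d2P h2].
  split=> // _; apply: dP => //; first by rewrite [f (a + _)]E.
  by have [-> _ _] := fP _ (Aseg t' t'01); have [-> _ _] := gP _ (Aseg t' t'01).
have r0 : 0 < N (f (c t) - g (c t)) / 2.
  by rewrite divr_gt0// N_gt0 subr_eq0; apply/eqP.
have [d1 d10 d1P] := cf _ r0; have [d2 d20 d2P] := cg _ r0.
have [|e e0 eP] := cc (Num.min d1 d2); first by rewrite lt_min d10.
exists e => // t' t'01 /eP; rewrite lt_min => /andP[/d1P h1 /d2P h2].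
split=> // E'; exfalso.
have h3 : N (f (c t') - g (c t)) < N (f (c t) - g (c t)) / 2 by rewrite [f (c t')]E'.
have := N_tri (f (c t)) (f (c t')) (g (c t)).
by have := N_distC (f (c t)) (f (c t')); move: h1 h3; rewrite -/(c t) -/(c t'); lra.
Qed.

Lemma cont_segment a (x : R) w : ctends (fun w => a + x%:C * (w - a)) w (a + x%:C * (w - a)).
Proof.
apply: ctendsD; first exact: ctends_cst.
exact: (ctendsM (ctends_cst _ w) (ctendsB (ctends_id w) (ctends_cst a w))).
Qed.

Lemma N_segment a (x r : R) w : N a <= r -> N w <= r -> 0 <= x <= 1 ->
  N (a + x%:C * (w - a)) <= r.
Proof.
move=> ar wr /andP[x0 x1].
have -> : a + x%:C * (w - a) = (1 - x)%:C * a + x%:C * w.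
  by rewrite rmorphB rmorph1 /=; ring.
apply: le_trans (le_normcD _ _) _; rewrite !Normc.normcM !N_real !ger0_norm ?subr_ge0//.
have := ler_wpM2l x0 wr; have : (1 - x) * N a <= (1 - x) * r by rewrite ler_wpM2l ?subr_ge0.
lra.
Qed.

(* The lift of w is obtained by following the segment from p 0 to w in n short
   steps, using at each step a local section through the current point. *)
Lemma lift_disc p r d : locally_injective p -> 0 < d -> N (p 0) <= r ->
  (forall y, N y <= r -> sections_near p y d) ->
  exists f, f (p 0) = 0 /\
    forall w, N w < r -> [/\ p (f w) = w, N (f w) < 1 & ctends f w (f w)].
Proof.
move=> inj d0; set a := p 0 => ar sec.
(* One section is fixed for every pair of a point and a preimage of it; all other pairs get a
   dummy. *)
have /choice[sg sgP] : forall yz : C * C, exists f, N yz.1 <= r -> N yz.2 < 1 ->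
    p yz.2 = yz.1 -> f yz.1 = yz.2 /\
    forall w, N (w - yz.1) < d -> [/\ p (f w) = w, N (f w) < 1 & ctends f w (f w)].
  move=> [y z] /=; have [[yr [z1 pz]]|no] := pselect (N y <= r /\ N z < 1 /\ p z = y).
    have [|f [fz fP]] := sec y yr z z1; first by rewrite pz subrr Normc.normc0.
    by exists f => _ _ _; rewrite -{1}pz.
  by exists id => yr z1 pz; case: no.
have r0 : 0 <= r := le_trans (N_ge0 _) ar.
(* Both ends of the segment have modulus at most r, so each of the n steps is shorter than d. *)
have [n n0 nd] : exists2 n, (0 < n)%N & n%:R^-1 * (2 * r) < d.
  have q0 : 0 <= 2 * r / d by rewrite divr_ge0 ?(ltW d0)// mulr_ge0.
  exists (Num.bound (2 * r / d)).+1 => //.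
  have : 2 * r / d < (Num.bound (2 * r / d)).+1%:R.
    by apply: lt_le_trans (archi_boundP q0) _; rewrite ler_nat.
  by rewrite ltr_pdivrMr// mulrC => h; rewrite ltr_pdivrMl ?ltr0n// mulrC.
pose pt j w := a + (j%:R / n%:R)%:C * (w - a).
pose L := fix L j w := if j is j'.+1 then sg (pt j' w, L j' w) (pt j w) else 0.
have nR : 0 < n%:R :> R by rewrite ltr0n.
have ptr j w : (j <= n)%N -> N w <= r -> N (pt j w) <= r.
  move=> jn wr; apply: N_segment => //.
  by rewrite divr_ge0//= ler_pdivrMr// mul1r ler_nat.
have step j w : N w <= r -> N (pt j.+1 w - pt j w) < d.
  move=> wr; have -> : pt j.+1 w - pt j w = (n%:R^-1)%:C * (w - a).
    by rewrite /pt -natr1 mulrDl rmorphD mul1r /=; ring.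
  rewrite Normc.normcM N_real gtr0_norm ?invr_gt0//; apply: le_lt_trans nd.
  rewrite ler_wpM2l ?invr_ge0//.
  by apply: le_trans (le_normcD _ _) _; rewrite normcN; lra.
have LP j w : (j <= n)%N -> N w <= r -> N (L j w) < 1 /\ p (L j w) = pt j w.
  elim: j => [|j IH] jn wr.
    by rewrite -[L 0%N w]/(0 : C) Normc.normc0 ltr01 /pt mul0r rmorph0 mul0r addr0.
  have [L1 pL] := IH (ltnW jn) wr.
  have [_ H] := sgP (pt j w, L j w) (ptr j w (ltnW jn) wr) L1 pL.
  by have [h1 h2 _] := H (pt j.+1 w) (step j w wr).
have Lc j w : (j <= n)%N -> N w < r -> ctends (L j) w (L j w).
  elim: j => [|j IH] jn wr; first exact: ctends_cst.
  have jn' := ltnW jn; have wr' := ltW wr.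
  have [L1 pL] := LP j w jn' wr'.
  have [fy fP] := sgP (pt j w, L j w) (ptr j w jn' wr') L1 pL; rewrite /= in fy fP.
  set f := sg (pt j w, L j w) in fy fP.
  have [_ _ cf] := fP _ (step j w wr').
  have cg : ctends (fun w' => f (pt j.+1 w')) w (L j.+1 w).
    exact: (ctends_comp (cont_segment a _ w) cf).
  (* At w' the recursion uses the section through [L j w'] instead of the section f through [L j w].
     The two agree at [pt j w'] by local injectivity of p, hence on the convex set where both are
     controlled. *)
  apply: ctends_near cg.
  have [e e0 eP] := inj _ L1.
  have yd : N (pt j w - pt j w) < d by rewrite subrr Normc.normc0.
  have [_ _ cfy] := fP _ yd.
  have cfpt : ctends (fun w' => f (pt j w')) w (f (pt j w)).
    exact: (ctends_comp (cont_segment a _ w) cfy).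
  have [d1 d10 d1P] := (ctendsP _ _ _).1 (IH jn' wr) _ e0.
  have [d2 d20 d2P] := (ctendsP _ _ _).1 cfpt _ e0.
  have s0 : 0 < d - N (pt j.+1 w - pt j w) by rewrite subr_gt0 step.
  have [d3 d30 d3P] := (ctendsP _ _ _).1 (cont_segment a (j.+1%:R / n%:R) w) _ s0.
  have [d4 d40 d4P] := (ctendsP _ _ _).1 (cont_segment a (j%:R / n%:R) w) _ d0.
  exists (Num.min (Num.min (Num.min d1 d2) (Num.min d3 d4)) (r - N w)).
    by rewrite !lt_min d10 d20 d30 d40 subr_gt0.
  move=> w'; rewrite !lt_min => /andP[/andP[/andP[wd1 wd2] /andP[wd3 wd4]] wwr].
  have w'r : N w' <= r by have := N_tri w' w 0; rewrite !subr0; lra.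
  have [L1' pL'] := LP j w' jn' w'r.
  have [fy' fP'] := sgP (pt j w', L j w') (ptr j w' jn' w'r) L1' pL'; rewrite /= in fy' fP'.
  have hpt : N (pt j w' - pt j w) < d by exact: d4P.
  have hpt1 : N (pt j.+1 w' - pt j w) < d.
    by have := d3P w' wd3; have := N_tri (pt j.+1 w') (pt j.+1 w) (pt j w); rewrite -!/(pt _ _); lra.
  pose A := [set y | N (y - pt j w) < d /\ N (y - pt j w') < d].
  apply: (section_unique (A := A) (a := pt j w') inj).
  - move=> t t01; have ball_convex (y x1 x2 : C) : N (x1 - y) < d -> N (x2 - y) < d ->
        N (x1 + t%:C * (x2 - x1) - y) < d.
      move=> h1 h2; have -> : x1 + t%:C * (x2 - x1) - y = (x1 - y) + t%:C * ((x2 - y) - (x1 - y)) by ring.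
      pose m := Num.max (N (x1 - y)) (N (x2 - y)).
      apply: (@le_lt_trans _ _ m); last by rewrite gt_max h1.
      by apply: N_segment; rewrite // le_max lexx ?orbT.
    split; apply: ball_convex => //; last exact: step.
    by rewrite subrr Normc.normc0.
  - by move=> y [yd1 _]; exact: fP.
  - by move=> y [_ yd2]; exact: fP'.
  rewrite fy'; apply: eP; [|exact: d1P|].
    by rewrite -fy; exact: d2P.
  by rewrite pL'; have [] := fP _ hpt.
have ptn w : pt n w = w.
  by rewrite /pt divff ?gt_eqF// rmorph1 mul1r subrKC.
exists (L n); split.
  have pta j : pt j a = a by rewrite /pt subrr mulr0 addr0.
  have : forall j, (j <= n)%N -> L j a = 0.
    elim=> [//|j IH] jn /=; rewrite !pta (IH (ltnW jn)).
    by have [->] := sgP (a, 0) ar (eq_ind_r (fun x => x < 1) ltr01 (Normc.normc0 R)) erefl.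
  by apply.
move=> w wr; have [L1 pL] := LP n w (leqnn n) (ltW wr).
by split; [rewrite pL ptn|exact: L1|exact: Lc].
Qed.

End Lifting.

(** * Comparison of densities *)


Section Density.
Context {R : realType}.
Local Notation C := R[i].
Local Notation N := (@Normc.normc R).
Local Notation M := (60 * 100 : R).
Implicit Types (z w l k a b c y : C) (f g h p : C -> C) (x s t e d r rho eps : R) (W : set C).

Lemma holomorphic_holo p : holomorphic_on unit_disc p -> holo p 0 1.
Proof.
move=> hp z; rewrite subr0 => z1; exists (derive1 p z); apply: cder_derivable; apply: hp.
exact/unit_discE.
Qed.

Lemma cderiv_derive1 p : holomorphic_on unit_disc p -> cderiv p 0 = derive1 p 0.
Proof. by move=> hp; apply/cderivE/cder_derivable/hp/unit_discE; rewrite Normc.normc0. Qed.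

Lemma covering_cderiv_neq0 p W z : holo p 0 1 -> covering_map unit_disc W p -> N z < 1 ->
  cderiv p z != 0.
Proof.
move=> hp cov z1; have Wpz : W (p z).
  by case: cov => _ <- _; exists z => //; exact/unit_discE.
have [d d0 /(_ z z1)] := covering_sections cov Wpz.
rewrite subrr Normc.normc0 => /(_ d0)[f [fz fP]].
have s0 : 0 < 1 - N z by rewrite subr_gt0.
have hpz : holo p (f (p z)) (1 - N z) by rewrite fz; apply: holo_sub hp _; rewrite subr0; lra.
by have := section_neq0 s0 hpz d0; rewrite fz; apply => w /fP[].
Qed.

(** The lift f satisfies p (f w) = w and f z = 0, so f' z = 1 / p' 0, and the modulus of this is the
    density. *)
Lemma density_upper W z rho r : hyperbolic_density W z rho -> N z < r ->
  (forall y, N y <= r -> W y) -> rho <= r / (r ^+ 2 - N z ^+ 2).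
Proof.
move=> [p [dp0 cov p0 ->]] zr discW; have hp := holomorphic_holo dp0.
have r0 : 0 < r := le_lt_trans (N_ge0 z) zr.
have dp := cderiv_derive1 dp0.
have inj := covering_locally_injective cov.
have [d d0 sec] : exists2 d, 0 < d & forall y, @cdisc R 0 r y -> sections_near p y d.
  apply: sections_uniform; first exact: cdisc_compact.
  by move=> y; rewrite /cdisc /= subr0 => /discW; exact: covering_sections cov.
have [||f [f0 fP]] := @lift_disc R p r d inj d0.
- by rewrite p0; exact: ltW zr.
- by move=> y yr; apply: sec; rewrite /cdisc /= subr0.
rewrite p0 in f0.
have df w : N w < r -> cder f w (cderiv p (f w))^-1.
  move=> wr; have [_ f1 cf] := fP w wr.
  have d1 : 0 < r - N w by rewrite subr_gt0.
  have near w' : N (w' - w) < r - N w -> p (f w') = w'.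
    by move=> h; have := N_tri w' w 0; rewrite !subr0 => ?; have [|] := fP w'; first lra.
  apply: cder_section d1 near cf (cderivP (hp _ _)) (covering_cderiv_neq0 hp cov f1).
  by rewrite subr0.
have hf : holo f 0 r by move=> w; rewrite subr0 => /df; exists (cderiv p (f w))^-1.
have := schwarz_pick r0 hf (fun w wr => let: And3 _ h _ := fP w wr in h) zr f0.
rewrite (cderivE (df z zr)) f0 -dp Normc.normcV -exprMn.
have D0 := disc_pos zr.
rewrite ler_pXn2r ?nnegrE ?(ltW r0)//; last first.
  by rewrite mulr_ge0 ?invr_ge0 ?N_ge0// ltW.
by rewrite ler_pdivlMr.
Qed.

(** Rational parametrisation of the circle, s = 3 e being the tangent of half the angle: |1 - k| = 2
    s / sqrt (1 + s ^ 2) lies between s and 2 s for s <= 1. *)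
Lemma unit_rotation w e : N w = 1 -> 0 < e -> e <= 3^-1 ->
  exists2 w', N w' = 1 & 3 * e <= N (w - w') <= 6 * e.
Proof.
move=> w1 e0 e3; pose s := 3 * e; pose k : C := ((1 - s ^+ 2) / (1 + s ^+ 2)) +i* (2 * s / (1 + s ^+ 2)).
have s0 : 0 < 1 + s ^+ 2 by rewrite ltr_wpDr ?sqr_ge0.
have k1 : N k ^+ 2 = 1.
  by rewrite N_sqr /=; field; rewrite gt_eqF.
have k2 : N (1 - k) ^+ 2 = 4 * s ^+ 2 / (1 + s ^+ 2).
  by rewrite N_sqr /=; field; rewrite gt_eqF.
exists (w * k).
  rewrite Normc.normcM w1 mul1r; apply/eqP.
  by rewrite -(eqrXn2 (n := 2)) ?N_ge0 ?ler01// k1 expr1n.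
have -> : w - w * k = w * (1 - k) by ring.
rewrite Normc.normcM w1 mul1r.
rewrite -(ler_pXn2r (n := 2)) ?nnegrE ?N_ge0//; last lra.
rewrite -[N _ <= _](ler_pXn2r (n := 2)) ?nnegrE ?N_ge0//; last lra.
rewrite k2 ler_pdivlMr// ler_pdivrMr// /s !exprMn.
have : e ^+ 2 <= 3^-1 ^+ 2 by rewrite ler_pXn2r// ?nnegrE; lra.
have := sqr_ge0 e; move: (e ^+ 2) => E; rewrite ![_%:R ^+ 2]expr2 exprVn expr2 => E0 E3.
have E9 : E <= 9^-1 by apply: le_trans E3 _; rewrite -natrM.
by apply/andP; split; nra.
Qed.

Lemma density_lower W z rho e : hyperbolic_density W z rho ->
  (exists2 r, N z < r & forall y, N y <= r -> W y) ->
  N z < 1 -> 0 < e -> e <= 3^-1 ->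
  (forall w, N w = 1 -> exists2 a, ~ W a & N (w - a) < e) ->
  (1 + M * e) / ((1 + M * e) ^+ 2 - N z ^+ 2) <= rho.
Proof.
move=> hd [r zr discW] z1 e0 e3 om; have rho_le := density_upper hd zr discW.
move: hd => [p [dp0 cov p0 rhoE]]; have hp := holomorphic_holo dp0.
have pW w : N w < 1 -> W (p w).
  by move=> w1; case: cov => _ <- _; exists w => //; exact/unit_discE.
have := density_lower_bound (f := p) hp e0; rewrite p0 => /(_ z1) H.
have {H} : N (cderiv p 0) ^+ 2 * ((1 + M * e) ^+ 2 / ((1 + M * e) ^+ 2 - N z ^+ 2) ^+ 2) <= 1.
  apply: H => w w1; have [w' w'1 /andP[ww1 ww2]] := unit_rotation w1 e0 e3.
  (* The omitted points a and b are less than e away from w and w', so |a - b| > 3 e - 2 e and |w -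
     b| < 6 e + e. *)
  have [a Wa wa] := om w w1; have [b Wb wb] := om w' w'1.
  exists a, b; split; last 2 first.
  - by lra.
  - by have := N_tri w w' b; lra.
  - by move=> y /pW Wy; split; apply/eqP => E; rewrite E in Wy.
  - have := N_tri w a w'; have := N_tri a b w'; rewrite (N_distC b w'); lra.
have : 1 < 1 + M * e by rewrite ltrDl mulr_gt0//; lra.
move: (1 + M * e) => rh rh1.
have D0 : 0 < rh ^+ 2 - N z ^+ 2 by apply: disc_pos; exact: lt_trans rh1.
have A0 : 0 <= N (cderiv p 0) * (rh / (rh ^+ 2 - N z ^+ 2)).
  by apply: mulr_ge0; [exact: N_ge0|apply: divr_ge0; apply: ltW => //; exact: lt_trans rh1].
rewrite -expr_div_n -exprMn expr_le1//.
have p'0 : cderiv p 0 != 0 by apply: covering_cderiv_neq0 hp cov _; rewrite Normc.normc0.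
rewrite rhoE -(cderiv_derive1 dp0) mulrC -ler_pdivlMr ?N_gt0// mul1r.
by apply.
Qed.

Lemma boundary_disc w : N w = 1 -> boundary unit_disc w.
Proof.
move=> w1; split; last first.
  by move=> /interior_subset/unit_discE; rewrite w1 ltxx.
move=> B /nbhsCP[e e0 eB].
pose x := Num.min (2^-1) (e / 2).
have x0 : 0 < x by rewrite lt_min invr_gt0 ltr0n divr_gt0.
have x1 : x <= 2^-1 by rewrite ge_min lexx.
have xe : x <= e / 2 by rewrite ge_min lexx orbT.
exists ((1 - x)%:C * w); split.
  by apply/unit_discE; rewrite Normc.normcM N_real w1 mulr1 ger0_norm; lra.
apply: eB; have -> : (1 - x)%:C * w - w = - (x%:C * w) by rewrite rmorphB rmorph1 /=; ring.
by rewrite normcN Normc.normcM N_real w1 mulr1 gtr0_norm//; lra.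
Qed.

Lemma boundary_discW w : boundary unit_disc w -> 1 <= N w.
Proof.
move=> [_ wD]; rewrite leNgt; apply/negP => w1; apply: wD.
apply/nbhsCP; exists (1 - N w); first by rewrite subr_gt0.
by move=> y yw; apply/unit_discE; have := N_tri y w 0; rewrite !subr0; lra.
Qed.

(** The infimum need not be attained; the factor 2 leaves room for an admissible radius. *)
Lemma hausdorff_near (A B : set C) eps : 0 < eps ->
  (hausdorff_dist A B <= eps%:E)%E ->
  (forall a, A a -> exists2 b, B b & N (a - b) < 2 * eps) /\
  (forall b, B b -> exists2 a, A a & N (b - a) < 2 * eps).
Proof.
move=> e0 H.
have : (hausdorff_dist A B < (2 * eps)%:E)%E by apply: le_lt_trans H _; rewrite lte_fin; lra.
move=> /ereal_inf_lt[_ [r [r0 AB BA] <-]]; rewrite lte_fin => re.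
split=> a Aa.
  by have [b Bb /ballCP h] := AB a Aa; exists b => //; exact: lt_trans re.
by have [b Bb /ballCP h] := BA a Aa; exists b => //; exact: lt_trans re.
Qed.

(** A segment from z inside the closed disc avoids the boundary of W, so membership in W is locally
    constant along it. *)
Lemma disc_subset W z r : open W -> W z -> N z <= r -> (forall a, boundary W a -> r < N a) ->
  forall y, N y <= r -> W y.
Proof.
move=> oW Wz zr bW y yr; pose P x := W (z + x%:C * (y - z)).
suff : P 1 by rewrite /P rmorph1 mul1r subrKC.
apply: locally_constant01; first by rewrite /P rmorph0 mul0r addr0.
move=> t t01; set c := z + t%:C * (y - z).
have cr : N c <= r by exact: N_segment.
have nb : ~ boundary W c by move=> /bW; rewrite ltNge cr.
have [e e0 eP] : exists2 e, 0 < e & forall w, N (w - c) < e -> (W w <-> W c).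
  have [Wc|nWc] := pselect (W c).
    have [e e0 eW] := (nbhsCP _ _).1 (open_nbhs_nbhs (conj oW Wc)).
    by exists e => // w /eW.
  have ncl : ~ closure W c by move=> cl; apply: nb; split => // /interior_subset.
  have [e e0 eW] : exists2 e, 0 < e & forall w, N (w - c) < e -> ~ W w.
    apply: contrapT => H; apply: ncl => B /nbhsCP[e e0 eB].
    apply: contrapT => H'; apply: H; exists e => // w we Ww; apply: H'.
    by exists w; split => //; exact: eB.
  by exists e => // w /eW.
exists (e / (N (y - z) + 1)) => [|t' t'01 tt]; first by rewrite divr_gt0// ltr_wpDl ?N_ge0.
apply: eP; have -> : z + t'%:C * (y - z) - c = (t' - t)%:C * (y - z) by rewrite /c rmorphB /=; ring.
rewrite Normc.normcM N_real; move: tt; rewrite ltr_pdivlMr ?ltr_wpDl ?N_ge0//.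
by have := normr_ge0 (t' - t); lra.
Qed.

(** Over the common denominator, which is at least m ^ 2 / 2, the numerator is (L + 1) e times (1 -
    e) (1 + L e) + x, and the latter is at most L + 2. *)
Lemma density_gap (x k e m L : R) : 0 <= x -> x <= k ^+ 2 -> 0 <= L -> 0 < e -> 0 < m ->
  m = 1 - k ^+ 2 -> e <= m / 4 -> e <= 3^-1 ->
  (1 - e) / ((1 - e) ^+ 2 - x) - (1 + L * e) / ((1 + L * e) ^+ 2 - x) <=
  (L + 1) * (L + 2) * 2 / m ^+ 2 * e.
Proof.
move=> x0 xk L0 e0 m0 mE e4 e3.
have m1 : m <= 1 by rewrite mE gerBl sqr_ge0.
have Le : 0 <= L * e by rewrite mulr_ge0// ltW.
have LeL : L * e <= L by rewrite ler_piMr//; lra.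
have D1 : m / 2 <= (1 - e) ^+ 2 - x.
  by have := sqr_ge0 e; have -> : (1 - e) ^+ 2 = 1 - 2 * e + e ^+ 2 by [ring]; lra.
have D2 : m <= (1 + L * e) ^+ 2 - x.
  have := sqr_ge0 (L * e); have -> : (1 + L * e) ^+ 2 = 1 + 2 * (L * e) + (L * e) ^+ 2 by ring.
  lra.
set a := (1 - e) ^+ 2 - x in D1 *; set b := (1 + L * e) ^+ 2 - x in D2 *.
have a0 : 0 < a by lra.
have b0 : 0 < b by lra.
have -> : (1 - e) / a - (1 + L * e) / b = ((L + 1) * e * ((1 - e) * (1 + L * e) + x)) / (a * b).
  have -> : (1 - e) / a - (1 + L * e) / b = ((1 - e) * b - (1 + L * e) * a) / (a * b).
    by field; rewrite !gt_eqF.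
  by congr (_ / _); rewrite /a /b; ring.
have ab : m ^+ 2 / 2 <= a * b.
  have -> : m ^+ 2 / 2 = m / 2 * m by field.
  by apply: ler_pM => //; lra.
have m20 : 0 < m ^+ 2 by rewrite exprn_gt0.
rewrite ler_pdivrMr ?mulr_gt0//.
have -> : (L + 1) * (L + 2) * 2 / m ^+ 2 * e * (a * b) = ((L + 1) * e) * ((L + 2) * (a * b / (m ^+ 2 / 2))).
  by field; rewrite gt_eqF.
apply: ler_wpM2l; first by rewrite mulr_ge0//; lra.
apply: le_trans (_ : (L + 2) * 1 <= _); last first.
  by rewrite ler_wpM2l//; [lra|rewrite ler_pdivlMr ?divr_gt0// mul1r].
rewrite mulr1; have : (1 - e) * (1 + L * e) <= 1 * (1 + L * e) by rewrite ler_wpM2r; lra.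
lra.
Qed.

End Density.

Unset Implicit Arguments.

Theorem theorem4 (R : realType) (K : set R[i])
    (cK : compact K) (KD : K `<=` unit_disc) :
  exists C eps0 : R, 0 < eps0 /\
    forall (eps : R) (W : set R[i]),
      0 < eps -> eps < eps0 ->
      domain W -> K `<=` W ->
      (hausdorff_dist (boundary unit_disc) (boundary W) <= eps%:E)%E ->
      forall z, K z ->
      forall rhoD rhoW : R,
        hyperbolic_density unit_disc z rhoD ->
        hyperbolic_density W z rhoW ->
        `|rhoD - rhoW| <= C * eps.
Proof.
(* An empty K has no point of largest modulus, but then the claim is vacuous. *)
have [K0|K0] := pselect (K !=set0); last first.
  by exists 0, 1; split => // eps W _ _ _ _ _ z Kz; case: K0; exists z.
have [|zm /KD/unit_discE zm1 zmax] := EVT_C (u := @Normc.normc R) cK K0.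
  by move=> z _; exact: rtends_normc.
set k := Normc.normc zm in zm1 zmax.
have k0 : 0 <= k by exact: N_ge0.
pose m : R := 1 - k ^+ 2; have m0 : 0 < m by rewrite /m subr_gt0 expr_lt1.
have m1 : m <= 1 by rewrite gerBl sqr_ge0.
pose L : R := 60 * 100.
have L0 : 0 <= L by rewrite /L; lra.
(* eps < m / 8 gives e = 2 eps <= m / 4, so that K lies in |z| < 1 - e; the last factor 2 turns e
   into eps. *)
exists ((L + 1) * (L + 2) * 2 / m ^+ 2 * 2), (m / 8); split; first by rewrite divr_gt0.
move=> eps W e0 em [oW _ _] KW /(hausdorff_near e0)[DW WD] z Kz rhoD rhoW hD hW.
pose e := 2 * eps; have e1 : 0 < e by rewrite mulr_gt0.
have e4 : e <= m / 4 by rewrite /e; lra.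
have e3 : e <= 3^-1 by lra.
have zk := zmax z Kz.
have kr : k < 1 - e.
  rewrite -(ltr_pXn2r (n := 2)) ?nnegrE//; last lra.
  have -> : (1 - e) ^+ 2 = 1 - 2 * e + e ^+ 2 by ring.
  by have := sqr_ge0 e; rewrite /m in e4 m0; lra.
have z1 : Normc.normc z < 1 by lra.
have zr : Normc.normc z < 1 - e by lra.
have x0 := sqr_ge0 (Normc.normc z).
have xk : Normc.normc z ^+ 2 <= k ^+ 2 by rewrite ler_pXn2r// nnegrE N_ge0.
have gap := density_gap x0 xk L0 e1 m0 erefl e4 e3.
(* The same two-sided bounds will enclose both densities, so their gap bounds the difference. *)
have bounds A rho : hyperbolic_density A z rho ->
    (forall y, Normc.normc y <= 1 - e -> A y) ->
    (forall w, Normc.normc w = 1 -> exists2 a, ~ A a & Normc.normc (w - a) < e) ->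
    (1 + L * e) / ((1 + L * e) ^+ 2 - Normc.normc z ^+ 2) <= rho <=
    (1 - e) / ((1 - e) ^+ 2 - Normc.normc z ^+ 2).
  move=> hA discA om; rewrite (density_upper hA zr discA) andbT.
  by apply: (density_lower hA) => //; exists (1 - e).
have /andP[lD uD] : (1 + L * e) / ((1 + L * e) ^+ 2 - Normc.normc z ^+ 2) <= rhoD <=
    (1 - e) / ((1 - e) ^+ 2 - Normc.normc z ^+ 2).
  apply: bounds hD _ _ => [y yr|w w1]; first by apply/unit_discE; lra.
  exists w; last by rewrite subrr Normc.normc0.
  by move=> /unit_discE; rewrite w1 ltxx.
have /andP[lW uW] : (1 + L * e) / ((1 + L * e) ^+ 2 - Normc.normc z ^+ 2) <= rhoW <=
    (1 - e) / ((1 - e) ^+ 2 - Normc.normc z ^+ 2).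
  apply: bounds hW _ _.
    apply: (disc_subset oW (KW z Kz) (ltW zr)) => a /WD[b /boundary_discW b1 ab].
    by have := N_tri b a 0; rewrite !subr0 (N_distC b a) /e; lra.
  move=> w /boundary_disc/DW[a [_ aW] wa]; exists a => // Wa; apply: aW.
  by move: oW; rewrite openE => /(_ a Wa).
have -> : (L + 1) * (L + 2) * 2 / m ^+ 2 * 2 * eps = (L + 1) * (L + 2) * 2 / m ^+ 2 * e.
  by rewrite -mulrA.
apply: le_trans gap.
by rewrite ler_norml; apply/andP; split; lra.
Qed.
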